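(* Consider a family of stabilizer codes of increasing size, each equipped with correction operations $\omega_\sigma$, a recovery procedure with syndrome-processing function $r$ and an encoding channel $C$, and, for each code, the stochastic classes $\mathbf L_\lambda$ ($\lambda\ge 0$) of local Pauli noise and $\mathbf R_\eta$ ($\eta\ge 0$) of noisy recovery. Suppose that for each code there is a parametrized family of stochastic classes $\mathbf N_\tau\subseteq\mathbf P$, $\tau\ge 0$ (residual noise), such that: (i) there are real functions $g_1(x)$, $g_2(x,y)$, $g_4(x)$, common to the whole family of codes, with limit $0$ at the origin and monotonically increasing (for $g_2$, in either argument when the other is fixed), whose values serve as parameters $\tau\ge 0$ below; (ii) for each code there are real functions $f_1(x)$, $f_2(x,y)$, $f_3(x)$, $f_4(x)$, and for each $i=1,2,3,4$ there is a neighborhood of the origin within which $f_i$ goes to zero in the limit of large codes; (iii) for each code the following relations hold (for all $\lambda,\eta,\tau,\tau_1,\tau_2\ge 0$): $$\mathbf L_\lambda\triangleleft_{f_1(\lambda)}\mathbf N_{g_1(\lambda)},\qquad \mathbf N_{\tau_1}\diamond\mathbf N_{\tau_2}\triangleleft_{f_2(\tau_1,\tau_2)}\mathbf N_{g_2(\tau_1,\tau_2)},$$ $$\mathrm{fail}(\mathbf N_\tau)\le f_3(\tau),\qquad \mathrm{eff}(\mathbf R_\eta)\triangleleft_{f_4(\eta)}\mathbf N_{g_4(\eta)};$$ (iv) for each code, $0\le\tau\le\tau'$ implies $\mathbf N_\tau\subseteq\mathbf N_{\tau'}$, and $\mathbf N_0=\{(1,\mathrm{id}_H)_{\mathbf g}\}$.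 For $\lambda,\eta\ge 0$ set $$\tau_1=g_4(\eta),\quad \tau_2=g_2(g_1(\lambda),\tau_1),\quad \delta_1=2f_4(\eta)+f_2(\tau_1,\tau_2)+f_3(g_2(\tau_1,\tau_2)),$$ $$\delta_2=f_1(\lambda)+f_2(g_1(\lambda),\tau_1),\quad \delta_3=f_3(\tau_1).$$ Then for each code the relations $$\mathbf R_\eta\diamond\mathbf N_{\tau_2}\circ C\triangleleft_{\delta_1}\mathbf N_{\tau_1}\circ C,\qquad \mathbf L_\lambda\diamond\mathbf N_{\tau_1}\circ C\triangleleft_{\delta_2}\mathbf N_{\tau_2}\circ C,$$ $$\mathbf L_\lambda\circ C\triangleleft_{\delta_2}\mathbf N_{\tau_2}\circ C,\qquad \mathrm{fail}(\mathbf N_{\tau_1})\le\delta_3$$ hold, and consequently for every integer $n\ge 1$ $$\mathrm{fail}\big((\mathbf R_\eta\diamond\mathbf L_\lambda)^{\diamond n}\big)\le n(\delta_1+\delta_2)+\delta_3 .$$ Moreover, for $\lambda$ and $\eta$ small enough (that is, $\lambda<\lambda_0$ and $\eta<\eta_0$ for some thresholds $\lambda_0,\eta_0>0$) the quantities $\delta_1,\delta_2,\delta_3$ go to zero in the limit of large codes, so that for any value of $n$ the error rate $\mathrm{fail}\big((\mathbf R_\eta\diamond\mathbf L_\lambda)^{\diamond n}\big)$ can be made arbitrarily small by choosing a large enough code in the family (the memory can preserve quantum information for arbitrarily long times).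
   Context: **Stochastic channels.** A stochastic channel $(p_i,E_i)$ is a probability distribution $p_i$ over a finite collection of quantum channels $E_i$ with common input and common output system; it can be identified with the formal sum $\sum_i p_iE_i$. A channel $E$ is identified with $(1,E)$. A stochastic class is a set of stochastic channels with common input and output systems; a stochastic channel is identified with the singleton class containing it. Indices in parentheses are summed over: $p_{i(j)}=\sum_jp_{ij}$, $p_{(i)j}=\sum_ip_{ij}$. Correlated composition: $\mathbf A\diamond\mathbf B$ is the set of stochastic channels of the form $(p_{ij},A_iB_j)$ with $(p_{i(j)},A_i)\in\mathbf A$ and $(p_{(i)j},B_j)\in\mathbf B$. It is associative, and $\mathbf A^{\diamond n}$ is the $n$-fold correlated composition. Composition with single channels is termwise: $A\circ(p_i,B_i)\circ C=(p_i,AB_iC)$; for classes it is applied to each element. Distance: two stochastic channels can always be written over a common list of distinct channels, $\mathcal A=(p_i,E_i)$, $\mathcal B=(p_i',E_i)$, and $\mathrm d(\mathcal A,\mathcal B)=\frac12\sum_i|p_i-p_i'|$. Write $\mathbf A\triangleleft_\epsilon\mathbf B$ if for every $\mathcal A\in\mathbf A$ there is $\mathcal B\in\mathbf B$ with $\mathrm d(\mathcal A,\mathcal B)\le\epsilon$. **Stabilizer (subsystem) code.** $H$ is the Hilbert space of a finite set of qubits. A set of commuting Pauli operators (check operators) is given, each with exactly one of its two eigenvalues compatible with the code. A syndrome $\sigma$ is the set of check operators with incompatible eigenvalue, also seen as a binary vector; $H=\bigoplus_\sigma H_\sigma$ over syndromes, all $H_\sigma$ having the same dimension; the sum modulo 2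 of two syndromes is a syndrome; $H_0$ is the code subspace. Pauli gauge operators generate an algebra $\mathfrak G$ whose elements map $H_0=H_{\rm logical}\otimes H_{\rm gauge}$ to itself, act trivially on $H_{\rm logical}$ and can arbitrarily transform $H_{\rm gauge}$; a similar decomposition applies to every $H_\sigma$. A Pauli operation is a channel $\rho\mapsto e\rho e^\dagger$ with $e$ a Pauli operator. $P_\sigma$ is the map $\rho\mapsto h\rho h$ with $h$ the projector onto $H_\sigma$. For each $\sigma$ a Pauli operation $\omega_\sigma$ with $\omega_\sigma P_\sigma=P_0\omega_\sigma$ is fixed (correction operation). Encoding: $C(\rho)=\rho\otimes\tau_*$ on $H_0$ for a fixed gauge state $\tau_*$. Decoding: $D(\rho)=\mathrm{Tr}_{\rm gauge}\sum_\sigma\omega_\sigma P_\sigma(\rho)$. Error rate: $\mathrm{fail}(\mathcal E)=\mathrm d(D\circ\mathcal E\circ C,\mathrm{id}_{\rm logical})$ for a stochastic channel on $H$, and $\mathrm{fail}(\mathbf A)=\sup_{\mathcal E\in\mathbf A}\mathrm{fail}(\mathcal E)$. **Suppressed gauge notation.** $(p_i,\sum_\sigma E_{i\sigma}P_\sigma)_{\mathbf g}$, with $E_{i\sigma}$ Pauli operations, denotes any stochastic channel of the form $(p_i,\sum_\sigma E_{i\sigma}P_\sigma G_{i\sigma})$ with $G_{i\sigma}$ quantum channels having Kraus operators in $\mathfrak G$; likewise $(p_i,E_i)_{\mathbf g}$, with $E_i$ Pauli operations, denotes any $(p_i,E_iG_i)$ with $G_i$ a channel with Kraus operators in $\mathfrak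 G$. For fixed $p_i$ and Pauli data, braces $\{(p_i,\cdot)_{\mathbf g}\}$ denote the set of all stochastic channels so described; in particular $\{(1,\mathrm{id}_H)_{\mathbf g}\}$ is the set of all stochastic channels denoted by $(1,\mathrm{id}_H)_{\mathbf g}$. **Classes.** $\mathbf P$: all stochastic channels $(p_i,E_i)_{\mathbf g}$ with $E_i$ Pauli operations. $\mathbf Q$: all stochastic channels of the form $(q_\sigma,R_\sigma)_{\mathbf g}$, where $R_\sigma=\sum_{\sigma'}\omega_{\sigma+\sigma'}P_{\sigma'}$. $\mathbf L_\lambda$: the stochastic channels that can be put in the form $(p_i,E_i)_{\mathbf g}\in\mathbf P$ so that for every set of qubits $S$, $\sum_{i:\,S\subseteq\mathrm{supp}\,E_i}p_i\le\lambda^{|S|}$, where $\mathrm{supp}\,E$ is the set of qubits on which $E$ acts non-trivially. Recovery: a round of measurements produces a binary vector $x$, and a function $r$ maps such vectors to syndromes; it satisfies $r(x+y)=\sigma+r(y)$ (addition modulo 2) for every binary vector $y$ of the same length whenever $x$ is an outcome compatible with syndrome $\sigma$ in the absence of errors. Binary vectors are identified with the set of positions where they equal $1$. $\mathbf R_\eta$: the stochastic channels $(p_y,R_{r(y)})_{\mathbf g}\in\mathbf Q$ (with $y$ running over bit-flip configurations of the measurement outcomes) such that for every binary vector $x$, $\sum_{y\supseteq x}p_y\le\eta^{|x|}$. For $\mathbf R\subseteq\mathbf Q$, $\mathrm{eff}(\mathbf R)\subseteq\mathbf P$ is the class containing the stochastic channels $(q_\sigma,\omega_\sigma)_{\mathbf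 g}$ such that $\mathbf R$ contains an element of the form $(q_\sigma,R_\sigma)_{\mathbf g}$. *)

(* Defs.v *)
From HB Require Import structures.
From mathcomp Require Import all_boot all_order all_algebra.
From mathcomp Require Import all_classical all_reals all_analysis.
From mathcomp Require Import complex mxtens.

Set Implicit Arguments.
Unset Strict Implicit.
Unset Printing Implicit Defensive.

Import Order.TTheory GRing.Theory Num.Theory.
Import numFieldNormedType.Exports.

Local Open Scope classical_set_scope.
Local Open Scope ring_scope.

Definition adjmx {R : realType} {m n} (A : 'M[R[i]]_(m, n)) : 'M[R[i]]_(n, m) :=
  (map_mx Num.conj A)^T.

(** Linear maps between operator spaces.  Channels are compared as functions
    on all matrices, so [=] is equality of channels. *)
Notation superop R m n := ('M[R[i]]_m -> 'M[R[i]]_n).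

Definition channel_with {R : realType} {m n} (S : set 'M[R[i]]_(n, m)) :
    set (superop R m n) :=
  [set E | exists (k : nat) (K : 'I_k -> 'M[R[i]]_(n, m)),
     [/\ forall j, S (K j),
         \sum_j adjmx (K j) *m K j = 1%:M &
         E = fun rho => \sum_j K j *m rho *m adjmx (K j)]].

Definition channel {R : realType} {m n} : set (superop R m n) :=
  channel_with [set: 'M[R[i]]_(n, m)].

(** A stochastic channel is represented by its formal sum: the function giving
    the total weight of each channel.  Listings that differ by merging or
    splitting equal channels, or by zero-weight terms, have the same formal
    sum. *)
Notation formal_sum R m n := (superop R m n -> R).

Definition prob {R : realType} {I : finType} (p : I -> R) : Prop :=
  (forall i, 0 <= p i) /\ \sum_i p i = 1.

(** The formal sum [\sum_i p_i E_i], written [(p_i, E_i)] in listings. *)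
Definition mix {R : realType} {m n} {I : finType}
    (p : I -> R) (E : I -> superop R m n) : formal_sum R m n :=
  fun F => \sum_(i | `[< E i = F >]) p i.

Definition schannel {R : realType} {m n} : set (formal_sum R m n) :=
  [set A | exists (I : finType) (p : I -> R) (E : I -> superop R m n),
     [/\ prob p, forall i, channel (E i) & A = mix p E]].

Definition sone {R : realType} {m n} (E : superop R m n) : formal_sum R m n :=
  mix (fun _ : unit => 1) (fun _ : unit => E).

(** Correlated composition; the maps of the class [X] act after those of [Y]. *)
Definition diamond {R : realType} {l m n}
    (X : set (formal_sum R m n)) (Y : set (formal_sum R l m)) :
    set (formal_sum R l n) :=
  [set Z | exists (I J : finType) (p : I -> J -> R)
      (A : I -> superop R m n) (B : J -> superop R l m),
     [/\ prob (fun ij : I * J => p ij.1 ij.2),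
         X (mix (fun i => \sum_j p i j) A),
         Y (mix (fun j => \sum_i p i j) B) &
         Z = mix (fun ij : I * J => p ij.1 ij.2)
                 (fun ij : I * J => A ij.1 \o B ij.2)]].

(** [n]-fold correlated composition for [1 <= n]; the value at [0] is junk. *)
Definition diamond_pow {R : realType} {m} (X : set (formal_sum R m m)) (n : nat) :
    set (formal_sum R m m) :=
  iter n.-1 (diamond X) X.

(** Image of a formal sum under a map applied to each of its channels.  The
    sum is over the finite support of [A] within a fibre of [phi]. *)
Definition termwise {R : realType} {k l m n}
    (phi : superop R k l -> superop R m n) (A : formal_sum R k l) :
    formal_sum R m n :=
  fun F => \sum_(E \in [set E | phi E = F]) A E.

Definition class_comp {R : realType} {l m n}
    (X : set (formal_sum R m n)) (C : superop R l m) : set (formal_sum R l n) :=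
  [set termwise (fun E => E \o C) A | A in X].

Definition sdist {R : realType} {m n} (A B : formal_sum R m n) : R :=
  2^-1 * \sum_(E \in [set: superop R m n]) `|A E - B E|.

Definition approx_class {R : realType} {m n}
    (X : set (formal_sum R m n)) (eps : R) (Y : set (formal_sum R m n)) : Prop :=
  forall A, X A -> exists2 B, Y B & sdist A B <= eps.

Inductive pauli1 := PI | PX | PY | PZ.

Definition pauli1_entry {R : realType} (P : pauli1) (a b : bool) : R[i] :=
  match P with
  | PI => (a == b)%:R
  | PX => (a != b)%:R
  | PY => if a == b then 0 else if a then 'i else - 'i
  | PZ => if a == b then (-1) ^+ a else 0
  end.

(** Pauli operators up to phase: tensor products of [1, X, Y, Z] over the
    qubits.  The phase is irrelevant for the operation [rho |-> e rho e^*]. *)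
Notation pauli Q := (Q -> pauli1).

(** Dimension of the Hilbert space of the qubits [Q], whose computational basis
    is indexed by [{ffun Q -> bool}]. *)
Definition qdim (Q : finType) : nat := #|{ffun Q -> bool}|.

Definition pauli_mx {R : realType} {Q : finType} (e : pauli Q) :
    'M[R[i]]_(qdim Q) :=
  \matrix_(a, b) \prod_(q : Q)
    pauli1_entry (e q) ((enum_val (a : 'I_#|{ffun Q -> bool}|) : {ffun Q -> bool}) q)
                       ((enum_val (b : 'I_#|{ffun Q -> bool}|) : {ffun Q -> bool}) q).

Definition pauli_op {R : realType} {Q : finType} (e : pauli Q) :
    superop R (qdim Q) (qdim Q) :=
  fun rho => pauli_mx e *m rho *m adjmx (pauli_mx e).

Definition supp {Q : finType} (e : pauli Q) : {set Q} :=
  [set q | if e q is PI then false else true].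

(** Sum modulo 2 of binary vectors, identified with sets of positions. *)
Definition add2 {T : finType} (x y : {set T}) : {set T} :=
  (x :\: y) :|: (y :\: x).

Record code_data (R : realType) := CodeData {
  qubit : finType;
  check : finType;
  check_op : check -> pauli qubit;
  (** the eigenvalue of [check_op c] compatible with the code is
      [(-1) ^+ check_val c] *)
  check_val : check -> bool;
  gaugeid : finType;
  gauge_op : gaugeid -> pauli qubit;
  ldim : nat;
  gdim : nat;
  (** isometry identifying [H_logical (x) H_gauge] with [H_0] *)
  emb : 'M[R[i]]_(qdim qubit, ldim * gdim);
  gstate : 'M[R[i]]_gdim;
  corr : {set check} -> pauli qubit
}.

Definition hdim {R : realType} (K : code_data R) : nat := qdim (qubit K).

(** Projector onto [H_s], the joint eigenspace of the commuting check operators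
    where exactly those in [s] have the incompatible eigenvalue. *)
Definition synd_proj {R : realType} (K : code_data R) (s : {set check K}) :
    'M[R[i]]_(hdim K) :=
  \prod_(c : check K)
    (2^-1 *: (1%:M + (-1) ^+ (check_val c (+) (c \in s)) *: pauli_mx (check_op c))).

(** Check operators need not be independent: the syndromes are the sets [s]
    with [H_s] nonzero. *)
Definition is_syndrome {R : realType} (K : code_data R) (s : {set check K}) :
    bool :=
  synd_proj s != 0.

Notation syndrome K := {s : {set check K} | is_syndrome s}.

Definition synd_op {R : realType} (K : code_data R) (s : {set check K}) :
    superop R (hdim K) (hdim K) :=
  fun rho => synd_proj s *m rho *m synd_proj s.

(** The (unital) algebra generated by the gauge operators. *)
Inductive gauge_alg {R : realType} (K : code_data R) : 'M[R[i]]_(hdim K) -> Prop :=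
| gauge_alg_gen j : gauge_alg (pauli_mx (@gauge_op R K j))
| gauge_alg1 : gauge_alg 1%:M
| gauge_algD A B : gauge_alg A -> gauge_alg B -> gauge_alg (A + B)
| gauge_algZ (z : R[i]) A : gauge_alg A -> gauge_alg (z *: A)
| gauge_algM A B : gauge_alg A -> gauge_alg B -> gauge_alg (A *m B).

(** [W] identifies [H_logical (x) H_gauge] with [H_s] so that the gauge algebra
    acts as all the operators [1 (x) a], and only as those. *)
Definition subsystem_decomposition {R : realType} (K : code_data R)
    (s : {set check K}) (W : 'M[R[i]]_(hdim K, ldim K * gdim K)) : Prop :=
  [/\ adjmx W *m W = 1%:M,
      W *m adjmx W = synd_proj s,
      forall g, gauge_alg g ->
        exists a : 'M[R[i]]_(gdim K), g *m W = W *m (1%:M *t a) &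
      forall a : 'M[R[i]]_(gdim K),
        exists2 g, gauge_alg g & g *m W = W *m (1%:M *t a)].

Definition is_state {R : realType} {n} (rho : 'M[R[i]]_n) : Prop :=
  (forall v : 'cV[R[i]]_n, 0 <= (adjmx v *m rho *m v) 0 0) /\ \tr rho = 1.

(** The positive dimensions amount to [H_0] being nonzero, i.e. to the
    prescribed eigenvalues being consistent.  That syndromes are closed under
    sums and that all [H_s] have equal dimension then follows. *)
Record is_code {R : realType} (K : code_data R) : Prop := IsCode {
  check_comm : forall c d : check K,
    pauli_mx (check_op c) *m pauli_mx (check_op d)
      = pauli_mx (check_op d) *m pauli_mx (check_op c) :> 'M[R[i]]_(hdim K);
  ldim_gt0 : (0 < ldim K)%N;
  gdim_gt0 : (0 < gdim K)%N;
  emb_decomposition : subsystem_decomposition finset.set0 (emb K);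
  synd_decomposition : forall s : {set check K}, is_syndrome s ->
    exists W, subsystem_decomposition s W;
  gstate_state : is_state (gstate K);
  corrP : forall s : {set check K}, is_syndrome s ->
    pauli_op (corr s) \o synd_op s = synd_op finset.set0 \o pauli_op (corr s)
}.

Definition encode {R : realType} (K : code_data R) : superop R (ldim K) (hdim K) :=
  fun rho => emb K *m (rho *t gstate K) *m adjmx (emb K).

Definition ptrace {R : realType} {m n} (A : 'M[R[i]]_(m * n)) : 'M[R[i]]_m :=
  \matrix_(a, b) \sum_(k < n) A (mxtens_index (a, k)) (mxtens_index (b, k)).

Definition decode {R : realType} (K : code_data R) : superop R (hdim K) (ldim K) :=
  fun rho => ptrace (adjmx (emb K)
    *m (\sum_(s : {set check K} | is_syndrome s)
          pauli_op (corr s) (synd_op s rho))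
    *m emb K).

Definition sfail {R : realType} (K : code_data R)
    (A : formal_sum R (hdim K) (hdim K)) : R :=
  sdist (termwise (fun E => @decode R K \o E \o @encode R K) A) (sone id).

Definition fail {R : realType} (K : code_data R)
    (X : set (formal_sum R (hdim K) (hdim K))) : R :=
  sup [set sfail A | A in X].

Definition gauge_channel {R : realType} (K : code_data R) :
    set (superop R (hdim K) (hdim K)) :=
  channel_with (@gauge_alg R K).

(** [E] up to gauge: the maps [E G]. *)
Definition up_to_gauge {R : realType} (K : code_data R)
    (E : superop R (hdim K) (hdim K)) : set (superop R (hdim K) (hdim K)) :=
  [set E \o G | G in @gauge_channel R K].

(** [\sum_s E_s P_s] up to gauge: the maps [\sum_s E_s P_s G_s]. *)
Definition sum_up_to_gauge {R : realType} (K : code_data R)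
    (e : {set check K} -> pauli (qubit K)) :
    set (superop R (hdim K) (hdim K)) :=
  [set F | exists2 G : {set check K} -> superop R (hdim K) (hdim K),
     forall s, gauge_channel (G s) &
     F = fun rho => \sum_(s : {set check K} | is_syndrome s)
                      pauli_op (e s) (synd_op s (G s rho))].

(** The set of stochastic channels denoted [(p_i, X_i)_g], where [X i] is the set
    of maps that [X_i] stands for up to gauge.  As [(p_i, X_i)] is a formal sum,
    it may be relisted as [(q_j, X_(l j))] with [p_i = \sum_(l j = i) q_j], and
    the gauge channels are chosen for each [j]: terms with equal Pauli data may
    carry different gauge channels. *)
Definition gauge_form {R : realType} (K : code_data R) {I : finType} (p : I -> R)
    (X : I -> set (superop R (hdim K) (hdim K))) :
    set (formal_sum R (hdim K) (hdim K)) :=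
  [set A | exists (J : finType) (l : J -> I) (q : J -> R)
      (F : J -> superop R (hdim K) (hdim K)),
     [/\ prob q, forall i, p i = \sum_(j | l j == i) q j,
         forall j, X (l j) (F j) & A = mix q F]].

(** The set of stochastic channels denoted [(1, id)_g]. *)
Definition gauge_id {R : realType} (K : code_data R) :
    set (formal_sum R (hdim K) (hdim K)) :=
  gauge_form (fun _ : unit => 1) (fun _ : unit => up_to_gauge id).

Definition classP {R : realType} (K : code_data R) :
    set (formal_sum R (hdim K) (hdim K)) :=
  [set A | exists (I : finType) (p : I -> R) (e : I -> pauli (qubit K)),
     prob p /\ gauge_form p (fun i => up_to_gauge (pauli_op (e i))) A].

(** [R_s = \sum_t omega_(s + t) P_t], up to gauge. *)
Definition recov {R : realType} (K : code_data R) (s : {set check K}) :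
    set (superop R (hdim K) (hdim K)) :=
  sum_up_to_gauge (fun t => corr (add2 s t)).

Definition classQ {R : realType} (K : code_data R) :
    set (formal_sum R (hdim K) (hdim K)) :=
  [set A | exists q : syndrome K -> R,
     prob q /\ gauge_form q (fun s => recov (val s)) A].

Definition classL {R : realType} (K : code_data R) (lambda : R) :
    set (formal_sum R (hdim K) (hdim K)) :=
  [set A | exists (I : finType) (p : I -> R) (e : I -> pauli (qubit K)),
     [/\ prob p, gauge_form p (fun i => up_to_gauge (pauli_op (e i))) A &
         forall S : {set qubit K},
           \sum_(i | S \subset supp (e i)) p i <= lambda ^+ #|S|]].

(** Measurement outcomes are binary vectors indexed by [meas].  [ideal s x] says
    that [x] is an outcome compatible with syndrome [s] in the absence of
    errors. *)
Record recovery {R : realType} (K : code_data R) := Recovery {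
  meas : finType;
  ideal : {set check K} -> {set meas} -> Prop;
  proc : {set meas} -> {set check K};
  proc_syndrome : forall x, is_syndrome (proc x);
  procD : forall (s : {set check K}) (x y : {set meas}),
    is_syndrome s -> ideal s x -> proc (add2 x y) = add2 s (proc y)
}.

Definition classR {R : realType} (K : code_data R) (V : recovery K) (eta : R) :
    set (formal_sum R (hdim K) (hdim K)) :=
  [set A | @classQ R K A /\
     exists p : {set meas V} -> R,
     [/\ prob p, gauge_form p (fun y => recov (proc y)) A &
         forall x : {set meas V},
           \sum_(y : {set meas V} | x \subset y) p y <= eta ^+ #|x|]].

Definition eff {R : realType} (K : code_data R)
    (X : set (formal_sum R (hdim K) (hdim K))) :
    set (formal_sum R (hdim K) (hdim K)) :=
  [set B | exists q : syndrome K -> R,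
     [/\ prob q,
         exists2 A, X A & gauge_form q (fun s => recov (val s)) A &
         gauge_form q (fun s => up_to_gauge (pauli_op (corr (val s)))) B]].

Definition tau1 {R : realType} (g4 : R -> R) (eta : R) : R := g4 eta.

Definition tau2 {R : realType} (g1 : R -> R) (g2 : R -> R -> R) (g4 : R -> R)
    (lambda eta : R) : R :=
  g2 (g1 lambda) (tau1 g4 eta).

Definition delta1 {R : realType} (g1 : R -> R) (g2 : R -> R -> R) (g4 : R -> R)
    (f2 : R -> R -> R) (f3 f4 : R -> R) (lambda eta : R) : R :=
  let t1 := tau1 g4 eta in
  let t2 := tau2 g1 g2 g4 lambda eta in
  2 * f4 eta + f2 t1 t2 + f3 (g2 t1 t2).

Definition delta2 {R : realType} (g1 g4 : R -> R) (f1 : R -> R)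
    (f2 : R -> R -> R) (lambda eta : R) : R :=
  f1 lambda + f2 (g1 lambda) (tau1 g4 eta).

Definition delta3 {R : realType} (g4 f3 : R -> R) (eta : R) : R :=
  f3 (tau1 g4 eta).

(* Main.v *)
(** A distance bound between two listings is the same thing as a coupling of them
    that fails with small probability, so all classes can be handled as random
    channels on one finite probability space that is enlarged at each step.

    Let [F = R_s] up to gauge act after a Pauli error [e] of syndrome [t].  On encoded
    states [F] applies [omega_(s + t)], leaving syndrome [s].  If decoding
    [omega_s e] gives the identity, then [omega_(s + t) omega_s e] preserves the code
    space and acts trivially on the logical system, hence acts there as a product of
    gauge operators, and [F e] agrees with [omega_s] up to gauge.  So a recovery round
    applied to residual noise [N_tau2] agrees on encoded states with an element of
    [eff R], which is close to [N_tau1], unless the decoding of [omega_s e] fails.  As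
    [(p, omega_s e)] is close to the correlated composition of [N_tau1] and [N_tau2],
    that has probability at most [f4 + f2 + f3]. *)
Require Import Defs.
From mathcomp Require Import all_boot all_order all_algebra.
From mathcomp Require Import all_classical all_reals all_analysis.
From mathcomp Require Import complex mxtens.
From mathcomp Require Import ring lra.

Set Implicit Arguments.
Unset Strict Implicit.
Unset Printing Implicit Defensive.

Import Order.TTheory GRing.Theory Num.Theory.
Import numFieldNormedType.Exports.

Local Open Scope classical_set_scope.
Local Open Scope ring_scope.

(** * Finite probability and couplings *)

(** The gauge system shapes the argument in two ways. Successful decoding is an identity for a
    single gauge state, possibly of low rank, so at first it determines [omega_(s + t) omega_s e]
    only on the range of that state, while recovery replaces the gauge state by another one. Since
    Pauli operators normalize the gauge algebra, which acts as the full matrix algebra on the gauge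
    factor, the form [1 (x) B] spreads to the whole code space. Some element of the gauge algebra
    then has this restriction, but that does not make it the Kraus operator of a channel: the
    normalization is demanded on all of [H], not on [H_0] alone. A monomial in the gauge operators
    is unitary everywhere, which is why one has to be found.

    The term [2 f4] in [delta1] comes from the order of choices: which outcomes decode correctly
    must be known before the gauge channels of the element of [eff R] can be adapted to them. *)

Definition Pr {R : realType} {Om : finType} (mu : Om -> R) (P : Om -> Prop) : R :=
  \sum_(w | `[< P w >]) mu w.

(** Enlargement of a probability space: old random variables are pulled back along [f], which by
    [mix_push] and [Pr_push] changes neither formal sums nor probabilities. *)
Definition pushes {R : realType} {Om' Om : finType}
    (mu' : Om' -> R) (f : Om' -> Om) (mu : Om -> R) : Prop :=
  forall w, \sum_(w' | f w' == w) mu' w' = mu w.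

Lemma asbool_eq {T : eqType} (x y : T) : `[< x = y >] = (x == y).
Proof. exact/asboolP/eqP. Qed.

Section Probability.
Context {R : realType}.
Implicit Types Om I J : finType.

Lemma Pr_ge0 Om (mu : Om -> R) P : prob mu -> 0 <= Pr mu P.
Proof. by move=> [mu0 _]; apply: sumr_ge0 => w _; exact: mu0. Qed.

Lemma Pr_le1 Om (mu : Om -> R) P : prob mu -> Pr mu P <= 1.
Proof.
move=> pm; have [mu0 <-] := pm; rewrite /Pr [leLHS]big_mkcond /=.
by apply: ler_sum => w _; case: ifP.
Qed.

Lemma Pr_union Om (mu : Om -> R) (P Q S : Om -> Prop) : prob mu ->
  (forall w, P w -> Q w \/ S w) -> Pr mu P <= Pr mu Q + Pr mu S.
Proof.
move=> [mu0 _] PQ; rewrite /Pr !(big_mkcond (fun w => `[< _ >])) -big_split /=.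
apply: ler_sum => w _; have := mu0 w.
by case: asboolP => [/PQ[] H|_] m0; rewrite ?(asboolT H); do ?case: ifP => _; lra.
Qed.

Lemma Pr_push Om' Om (mu' : Om' -> R) (f : Om' -> Om) mu P :
  pushes mu' f mu -> Pr mu' (fun w => P (f w)) = Pr mu P.
Proof.
move=> pf; rewrite /Pr (partition_big f (fun w => `[< P w >])) //=.
apply: eq_bigr => w /asboolP Pw; rewrite -pf; apply: eq_bigl => w'.
by case: eqP => [->|]; rewrite ?andbF // andbT; apply: asboolT.
Qed.

Lemma prob_push Om' Om (mu' : Om' -> R) (f : Om' -> Om) mu :
  pushes mu' f mu -> prob mu -> (forall w, 0 <= mu' w) -> prob mu'.
Proof.
move=> pf [_ mu1] m0; split=> //; rewrite -mu1 (partition_big f xpredT) //=.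
by apply: eq_bigr => w _; rewrite -pf.
Qed.

Lemma pushes_comp Om'' Om' Om (mu'' : Om'' -> R) mu' mu (f : Om'' -> Om')
    (g : Om' -> Om) :
  pushes mu'' f mu' -> pushes mu' g mu -> pushes mu'' (g \o f) mu.
Proof.
move=> pf pg w; rewrite -pg (partition_big f (fun w' => g w' == w)) //=.
apply: eq_bigr => w' /eqP gw; rewrite -pf; apply: eq_bigl => w''.
by case: (f w'' =P w') => [->|]; rewrite ?andbF // gw eqxx.
Qed.

Lemma mix_push m n Om' Om (mu' : Om' -> R) (f : Om' -> Om) mu
    (A : Om -> superop R m n) :
  pushes mu' f mu -> mix mu' (A \o f) = mix mu A.
Proof.
by move=> pf; apply/funext => F; exact: (Pr_push (fun w => A w = F) pf).
Qed.

Lemma prod_prob I J (p : I -> R) (q : J -> R) : prob p -> prob q ->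
  prob (fun ij : I * J => p ij.1 * q ij.2).
Proof.
move=> [p0 p1] [q0 q1]; split=> [ij|]; first by rewrite mulr_ge0.
rewrite -(pair_bigA _ (fun i j => p i * q j)) /= -p1.
by apply: eq_bigr => i _; rewrite -mulr_sumr q1 mulr1.
Qed.

(** Expectation computed from the law of [A]. The list [s] stands in for the range, as the type of
    maps is infinite. *)
Lemma sum_mix m n Om (mu : Om -> R) (A : Om -> superop R m n)
    (s : seq (superop R m n)) (g : superop R m n -> R) :
  uniq s -> (forall w, A w \in s) ->
  \sum_w mu w * g (A w) = \sum_(x <- s) mix mu A x * g x.
Proof.
move=> us As; rewrite /mix; under [RHS]eq_bigr do rewrite mulr_suml big_mkcond.
rewrite exchange_big /=; apply: eq_bigr => w _.
rewrite (bigD1_seq (A w)) //= asboolT // big1 ?addr0 // => x xA.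
by rewrite asboolF // => e; rewrite e eqxx in xA.
Qed.

Lemma mix0 m n Om (mu : Om -> R) (A : Om -> superop R m n)
    (s : seq (superop R m n)) x : (forall w, A w \in s) -> x \notin s ->
  mix mu A x = 0.
Proof.
move=> As xs; rewrite /mix big1 // => w /asboolP e.
by rewrite -e As in xs.
Qed.

Lemma mix_ge0 m n Om (mu : Om -> R) (A : Om -> superop R m n) x :
  (forall w, 0 <= mu w) -> 0 <= mix mu A x.
Proof. by move=> m0; apply: sumr_ge0. Qed.

Lemma mix_ge m n Om (mu : Om -> R) (A : Om -> superop R m n) w :
  (forall w, 0 <= mu w) -> mu w <= mix mu A (A w).
Proof.
move=> m0; rewrite /mix (bigD1 w) ?asboolT //= lerDl.
by apply: sumr_ge0.
Qed.

(** Both formal sums vanish off this list, so the sum over all maps in [sdist] becomes a finite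
    one. *)
Definition values {m n} {I J} (A : I -> superop R m n) (B : J -> superop R m n) :=
  undup (codom A ++ codom B).

Lemma valuesl m n I J (A : I -> superop R m n) (B : J -> superop R m n) i :
  A i \in values A B.
Proof. by rewrite mem_undup mem_cat codom_f. Qed.

Lemma valuesr m n I J (A : I -> superop R m n) (B : J -> superop R m n) i :
  B i \in values A B.
Proof. by rewrite mem_undup mem_cat codom_f orbT. Qed.

Lemma sdist_mix m n I J (p : I -> R) (q : J -> R) (A : I -> superop R m n)
    (B : J -> superop R m n) :
  sdist (mix p A) (mix q B) =
    2^-1 * \sum_(x <- values A B) `|mix p A x - mix q B x|.
Proof.
congr (_ * _); rewrite (@fsbigE _ _ _ _ _ (values A B)) ?undup_uniq //.
  by apply: eq_bigl => x; rewrite in_setT.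
move=> x _ xs; rewrite !(mix0 _ (s := values A B) _ xs) ?subrr ?normr0 // => w.
  exact: valuesr.
exact: valuesl.
Qed.

(** Easy half of the coupling inequality: outcomes with [A w = B w] cancel, and every other one is
    counted at most twice, at [A w] and at [B w], which the factor [2^-1] absorbs. *)
Lemma sdist_mix_le m n Om (mu : Om -> R) (A B : Om -> superop R m n) :
  prob mu -> sdist (mix mu A) (mix mu B) <= Pr mu (fun w => A w <> B w).
Proof.
move=> [m0 _]; rewrite sdist_mix ler_pdivrMl //.
have le1 x : `|mix mu A x - mix mu B x| <=
    \sum_(w | `[< A w <> B w >]) mu w * ((A w == x)%:R + (B w == x)%:R).
  rewrite /mix (big_mkcond (fun w => `[< A w = x >])).
  rewrite (big_mkcond (fun w => `[< B w = x >])) -sumrB [leRHS]big_mkcond /=.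
  apply: le_trans (ler_norm_sum _ _ _) _; apply: ler_sum => w _.
  rewrite !asbool_eq; have := m0 w; case: asboolP => [_|/contrapT->] mw.
    by do 2 case: ifP => _ /=; rewrite ler_norml; apply/andP; split; lra.
  by rewrite subrr normr0.
apply: le_trans (ler_sum _ (fun x _ => le1 x)) _.
rewrite exchange_big /= /Pr mulr_sumr; apply: ler_sum => w _.
rewrite -mulr_sumr mulrC; apply: ler_wpM2r => //.
have one y : \sum_(x <- values A B) ((y == x)%:R : R) <= 1.
  case: (boolP (y \in values A B)) => ys.
    rewrite (bigD1_seq y) ?undup_uniq //= eqxx big1 ?addr0 // => x.
    by rewrite eq_sym => /negPf->.
  by rewrite big_seq big1 // => x xs; case: eqP => // e; rewrite e xs in ys.
by rewrite big_split /=; have := one (A w); have := one (B w); lra.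
Qed.

Lemma mix_ae m n Om (mu : Om -> R) (A B : Om -> superop R m n) :
  prob mu -> Pr mu (fun w => A w <> B w) <= 0 -> mix mu A = mix mu B.
Proof.
move=> pm le0; have [m0 _] := pm.
have z w : A w <> B w -> mu w = 0.
  move=> AB; apply/le_anti; rewrite m0 andbT; apply: le_trans le0.
  by rewrite /Pr (bigD1 w) ?asboolT //= lerDl; apply: sumr_ge0.
apply/funext => F; rewrite /mix [LHS]big_mkcond [RHS]big_mkcond /=.
apply: eq_bigr => w _; have [-> //|/eqP/z ->] := eqVneq (A w) (B w).
by rewrite !if_same.
Qed.

(** The deficit at [E] and the total weight elsewhere are both the probability of missing [E]. This
    makes [sfail] exactly the probability of an event. *)
Lemma sdist_sone m n Om (mu : Om -> R) (A : Om -> superop R m n) E :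
  prob mu -> sdist (mix mu A) (sone E) = Pr mu (fun w => A w <> E).
Proof.
move=> pm; have [m0 m1] := pm; rewrite /sone sdist_mix.
set s := values _ _; have Es : E \in s by exact: (valuesr A (fun=> E) tt).
have mE x : mix (fun _ : unit => 1 : R) (fun=> E) x = (E == x)%:R.
  rewrite /mix big_mkcond /= (big_pred1 tt); last by case.
  by rewrite asbool_eq; case: ifP.
have tot : 1 = mix mu A E + Pr mu (fun w => A w <> E).
  rewrite -m1 (bigID (fun w => `[< A w = E >])) /=; congr (_ + _).
  by apply: eq_bigl => w; rewrite asbool_neg.
have sum1 : \sum_(x <- s) mix mu A x = 1.
  rewrite -m1; under [RHS]eq_bigr do rewrite -[mu _]mulr1.
  rewrite (sum_mix mu (A := A) (s := s) (fun=> 1)) ?undup_uniq //.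
    by apply: eq_bigr => x _; rewrite mulr1.
  by move=> w; exact: valuesl.
rewrite (bigD1_seq E) ?undup_uniq //= mE eqxx.
rewrite (eq_bigr (fun x => mix mu A x)); last first.
  move=> x xE; rewrite mE eq_sym (negPf xE) subr0 ger0_norm //.
  exact: mix_ge0.
move: sum1; rewrite (bigD1_seq E) ?undup_uniq //= => sum1.
have P0 : 0 <= Pr mu (fun w => A w <> E) by exact: Pr_ge0.
rewrite [`|_|]ler0_norm ?subr_le0; last by lra.
have -> : \sum_(i <- s | i != E) mix mu A i = 1 - mix mu A E by lra.
lra.
Qed.

Lemma termwise_mix k l m n (phi : superop R k l -> superop R m n) Om
    (mu : Om -> R) A :
  termwise phi (mix mu A) = mix mu (phi \o A).
Proof.
apply/funext => F; rewrite /termwise fsbig_mkcond.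
have As w : A w \in undup (codom A) by rewrite mem_undup codom_f.
rewrite (@fsbigE _ _ _ _ _ (undup (codom A))) ?undup_uniq //; last first.
  by move=> E _ Es; rewrite /patch (mix0 _ As) // if_same.
transitivity (\sum_(x <- undup (codom A)) mix mu A x * (phi x == F)%:R).
  rewrite (eq_bigl xpredT) => [|x]; last by rewrite in_setT.
  apply: eq_bigr => x _; rewrite /patch; case: eqP => e.
    by rewrite mem_set // mulr1.
  by rewrite memNset // mulr0.
rewrite -(sum_mix mu (fun x => (phi x == F)%:R)) ?undup_uniq //.
rewrite /mix [RHS]big_mkcond /=; apply: eq_bigr => w _; rewrite asbool_eq.
by case: eqP; rewrite ?mulr1 ?mulr0.
Qed.

(* The common part [min a b] of the two formal sums is coupled along the diagonal and
   the two excesses, of total weight [D] each, independently. *)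
Lemma couple m n I J (p : I -> R) (q : J -> R) (A : I -> superop R m n)
    (B : J -> superop R m n) : prob p -> prob q ->
  exists2 r : I * J -> R, (forall ij, 0 <= r ij) &
    [/\ pushes r fst p, pushes r snd q &
        Pr r (fun ij => A ij.1 <> B ij.2) <= sdist (mix p A) (mix q B)].
Proof.
move=> pp pq; have [p0 p1] := pp; have [q0 q1] := pq.
set s := values A B; set a := mix p A; set b := mix q B.
pose c x := Num.min (a x) (b x).
have As w : A w \in s by exact: valuesl.
have Bs w : B w \in s by exact: valuesr.
have us : uniq s by exact: undup_uniq.
have a0 x : 0 <= a x by exact: mix_ge0.
have b0 x : 0 <= b x by exact: mix_ge0.
have c0 x : 0 <= c x by rewrite le_min a0 b0.
have ca x : c x <= a x by rewrite ge_min lexx.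
have cb x : c x <= b x by rewrite ge_min lexx orbT.
have suma : \sum_(x <- s) a x = 1.
  rewrite -p1; under [RHS]eq_bigr do rewrite -[p _]mulr1.
  by rewrite (sum_mix p (fun=> 1) us As); apply: eq_bigr => x _; rewrite mulr1.
have sumb : \sum_(x <- s) b x = 1.
  rewrite -q1; under [RHS]eq_bigr do rewrite -[q _]mulr1.
  by rewrite (sum_mix q (fun=> 1) us Bs); apply: eq_bigr => x _; rewrite mulr1.
set D := \sum_(x <- s) (a x - c x).
have Db : D = \sum_(x <- s) (b x - c x) by rewrite /D !sumrB suma sumb.
have D0 : 0 <= D by apply: sumr_ge0 => x _; rewrite subr_ge0.
have dD : sdist (mix p A) (mix q B) = D.
  rewrite sdist_mix -/s -/a -/b.
  have -> : \sum_(x <- s) `|a x - b x| = D + D.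
    rewrite {2}Db -big_split /=; apply: eq_bigr => x _.
    rewrite /c; case: (leP (a x) (b x)) => ab.
      by rewrite ler0_norm ?subr_le0 //; ring.
    by rewrite ger0_norm ?subr_ge0 ?(ltW ab) //; ring.
  by field.
(* [u] and [v] spread the excesses over the indices, in proportion to [p] and [q] among those with
   the same channel. Division by 0 gives 0, and [p i = 0] there anyway. *)
pose u i := p i * ((a (A i) - c (A i)) / a (A i)).
pose v j := q j * ((b (B j) - c (B j)) / b (B j)).
have pA i : a (A i) = 0 -> p i = 0.
  move=> e; apply/le_anti; rewrite p0 andbT -e; exact: mix_ge.
have qB j : b (B j) = 0 -> q j = 0.
  move=> e; apply/le_anti; rewrite q0 andbT -e; exact: mix_ge.
have u0 i : 0 <= u i by rewrite mulr_ge0 // divr_ge0 // subr_ge0.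
have v0 j : 0 <= v j by rewrite mulr_ge0 // divr_ge0 // subr_ge0.
have sumu : \sum_i u i = D.
  rewrite (sum_mix p (fun x => (a x - c x) / a x) us As) -/a; apply: eq_bigr => x _.
  have [a_0|/eqP az] := eqVneq (a x) 0; last by field; apply/eqP.
  by have := ca x; have := c0 x; rewrite a_0 mul0r; lra.
have sumv : \sum_j v j = D.
  rewrite (sum_mix q (fun x => (b x - c x) / b x) us Bs) -/b Db; apply: eq_bigr => x _.
  have [b_0|/eqP bz] := eqVneq (b x) 0; last by field; apply/eqP.
  by have := cb x; have := c0 x; rewrite b_0 mul0r; lra.
(* Given a common channel [x], drawn with weight [c x], the two indices are independent with
   conditional laws [p i / a x] and [q j / b x]. *)
pose h x : R := c x / (a x * b x).
pose r (ij : I * J) : R :=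
  (if A ij.1 == B ij.2 then p ij.1 * q ij.2 * h (A ij.1) else 0) + u ij.1 * v ij.2 / D.
have h0 x : 0 <= h x by rewrite divr_ge0 ?mulr_ge0.
have r0 ij : 0 <= r ij.
  apply: addr_ge0; last exact: divr_ge0 (mulr_ge0 (u0 _) (v0 _)) D0.
  by case: ifP => // _; exact: mulr_ge0 (mulr_ge0 (p0 _) (q0 _)) (h0 _).
(* If [D = 0] then [u] and [v] vanish, so the default value of the quotient by [D] does no harm. *)
have DuD t : (D = 0 -> t = 0) -> t * D / D = t.
  have [-> /(_ erefl)->|Dn _] := eqVneq D 0; first by rewrite !mul0r.
  by rewrite mulfK.
exists r => //; split.
- move=> i; rewrite (eq_bigl (fun ij : I * J => (ij.1 == i) && true)); last first.
    by move=> ij; rewrite andbT.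
  rewrite -(pair_big (pred1 i) xpredT (fun i j => r (i, j))) /= big_pred1_eq.
  rewrite /r /= big_split /= -big_mkcond /=.
  have -> : \sum_j u i * v j / D = u i * D / D by rewrite -sumv mulr_sumr mulr_suml.
  rewrite DuD; last first.
    move=> Dz; move: sumu => /eqP; rewrite Dz psumr_eq0 //.
    by move=> /allP/(_ i (mem_index_enum i))/eqP.
  rewrite -mulr_suml -mulr_sumr.
  have -> : \sum_(j | A i == B j) q j = b (A i).
    by apply: eq_bigl => j; apply/eqP/asboolP => ->.
  rewrite /u /h; have [az|az] := eqVneq (a (A i)) 0; first by rewrite pA // !mul0r addr0.
  have [bz|bz] := eqVneq (b (A i)) 0.
    have -> : c (A i) = 0 by have := cb (A i); have := c0 (A i); rewrite bz; lra.
    by rewrite subr0 divff // bz !mulr0 !mul0r; ring.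
  by field; rewrite az bz.
- move=> j; rewrite (eq_bigl (fun ij : I * J => true && (ij.2 == j))) //.
  rewrite -(pair_big xpredT (pred1 j) (fun i j => r (i, j))) /=.
  under eq_bigr do rewrite big_pred1_eq.
  rewrite /r /= big_split /= -big_mkcond /=.
  have -> : \sum_i u i * v j / D = v j * D / D.
    by rewrite -sumu [v j * _]mulrC !mulr_suml.
  rewrite DuD; last first.
    move=> Dz; move: sumv => /eqP; rewrite Dz psumr_eq0 //.
    by move=> /allP/(_ j (mem_index_enum j))/eqP.
  rewrite (eq_bigr (fun i => p i * (q j * h (B j)))); last first.
    by move=> i /eqP->; rewrite mulrA.
  rewrite -mulr_suml.
  have -> : \sum_(i | A i == B j) p i = a (B j).
    by apply: eq_bigl => i; apply/eqP/asboolP.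
  rewrite /v /h; have [bz|bz] := eqVneq (b (B j)) 0.
    by rewrite qB // !(mul0r, mulr0) addr0.
  have [az|az] := eqVneq (a (B j)) 0.
    have -> : c (B j) = 0 by have := ca (B j); have := c0 (B j); rewrite az; lra.
    by rewrite subr0 divff // az !mul0r; ring.
  by field; rewrite az bz.
(* Only the product part charges pairs with different channels, and its total mass is
   [D * D / D]. *)
- rewrite dD -[leRHS]DuD // -{1}sumu -{1}sumv mulr_suml.
  under [in leRHS]eq_bigr do rewrite mulr_sumr.
  rewrite pair_bigA /= mulr_suml /Pr [leLHS]big_mkcond /=; apply: ler_sum => ij _.
  case: asboolP => [AB|_]; last exact: divr_ge0 (mulr_ge0 (u0 _) (v0 _)) D0.
  by rewrite /r; case: eqP => // _; rewrite add0r.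
Qed.

End Probability.

(** * Stochastic classes *)
(** A formal sum is any real function on maps; couplings need one that comes from a finite
    probability space. *)
Definition listed {R : realType} {m n} (X : set (formal_sum R m n)) : Prop :=
  forall A, X A -> exists (I : finType) (p : I -> R) (E : I -> superop R m n),
    prob p /\ A = mix p E.

Section Classes.
Context {R : realType}.
Implicit Types Om I J : finType.

Lemma Pr_union_le Om (mu : Om -> R) (P Q S : Om -> Prop) a b : prob mu ->
  Pr mu Q <= a -> Pr mu S <= b -> (forall w, P w -> Q w \/ S w) ->
  Pr mu P <= a + b.
Proof. by move=> pm Qa Sb PQ; apply: le_trans (Pr_union pm PQ) (lerD Qa Sb). Qed.

(** The joint law sits on the diagonal of [Om * Om]. Together with [diamondE], correlated
    composition is pointwise composition of random channels on a common space. *)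
Lemma diamond_mix l m n (X : set (formal_sum R m n)) (Y : set (formal_sum R l m))
    Om (mu : Om -> R) A B : prob mu ->
  X (mix mu A) -> Y (mix mu B) -> diamond X Y (mix mu (fun w => A w \o B w)).
Proof.
move=> [m0 m1] XA YB; pose p i j := if i == j then mu i else 0.
have p1 i : \sum_j p i j = mu i.
  by rewrite (bigD1 i) //= /p eqxx big1 ?addr0 // => j /negPf ji; rewrite eq_sym ji.
have p2 j : \sum_i p i j = mu j.
  by rewrite (bigD1 j) //= /p eqxx big1 ?addr0 // => i /negPf ->.
have pp : pushes mu (fun w => (w, w)) (fun ij : Om * Om => p ij.1 ij.2).
  move=> [i j] /=; rewrite /p; have [<-|ij] := eqVneq i j.
    by rewrite (big_pred1 i) // => w; rewrite xpair_eqE andbb.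
  rewrite big1 // => w; rewrite xpair_eqE => /andP[/eqP wi /eqP wj].
  by rewrite -wi -wj eqxx in ij.
exists Om, Om, p, A, B; split.
- split=> [ij|]; first by rewrite /p; case: ifP.
  by rewrite -(pair_bigA _ p) /= -m1; apply: eq_bigr => i _.
- by rewrite (_ : (fun i => _) = mu) //; apply/funext.
- by rewrite (_ : (fun i => _) = mu) //; apply/funext.
- exact: (mix_push (fun ij : Om * Om => A ij.1 \o B ij.2) pp).
Qed.

Lemma diamondE l m n (X : set (formal_sum R m n)) (Y : set (formal_sum R l m)) Z :
  diamond X Y Z -> exists Om (mu : Om -> R) A B,
    [/\ prob mu, X (mix mu A), Y (mix mu B) & Z = mix mu (fun w => A w \o B w)].
Proof.
move=> [I [J [p [A [B [pp XA YB ->]]]]]].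
exists (I * J)%type, (fun ij => p ij.1 ij.2), (A \o fst), (B \o snd); split=> //.
- rewrite (mix_push (mu := fun i => \sum_j p i j)) // => i.
  rewrite (eq_bigl (fun ij : I * J => (ij.1 == i) && true)); last first.
    by move=> ij; rewrite andbT.
  by rewrite -(pair_big (pred1 i) xpredT p) /= big_pred1_eq.
- rewrite (mix_push (mu := fun j => \sum_i p i j)) // => j.
  rewrite (eq_bigl (fun ij : I * J => true && (ij.2 == j))) //.
  rewrite -(pair_big xpredT (pred1 j) p) /=.
  by apply: eq_bigr => i _; rewrite big_pred1_eq.
Qed.

Lemma listed_diamond l m n (X : set (formal_sum R m n)) (Y : set (formal_sum R l m)) :
  listed (diamond X Y).
Proof.
by move=> Z /diamondE[Om [mu [A [B [pm _ _ ->]]]]]; exists Om, mu, (fun w => A w \o B w).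
Qed.

Lemma listed_diamond_pow m (X : set (formal_sum R m m)) n :
  listed X -> listed (diamond_pow X n).
Proof. by case: n => [|[|n]] //= _; exact: listed_diamond. Qed.

(** Witnessed by independent factors. Nonemptiness matters because [fail] is a [sup], which inherits
    a bound on its elements only when there are some. *)
Lemma diamond_neq0 l m n (X : set (formal_sum R m n)) (Y : set (formal_sum R l m)) :
  listed X -> listed Y -> X !=set0 -> Y !=set0 -> diamond X Y !=set0.
Proof.
move=> lX lY [A XA] [B YB].
have [I [p [E [pp eA]]]] := lX _ XA; have [J [q [F [qq eB]]]] := lY _ YB.
pose r (ij : I * J) := p ij.1 * q ij.2.
have pr : prob r by exact: prod_prob.
exists (mix r (fun ij => E ij.1 \o F ij.2)); apply: diamond_mix => //.
- rewrite (mix_push (f := fst) (mu := p) E) -?eA // => i.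
  rewrite (eq_bigl (fun ij : I * J => (ij.1 == i) && true)); last first.
    by move=> ij; rewrite andbT.
  rewrite -(pair_big (pred1 i) xpredT (fun i j => p i * q j)) /= big_pred1_eq.
  by rewrite -mulr_sumr qq.2 mulr1.
- rewrite (mix_push (f := snd) (mu := q) F) -?eB // => j.
  rewrite (eq_bigl (fun ij : I * J => true && (ij.2 == j))) //.
  rewrite -(pair_big xpredT (pred1 j) (fun i j => p i * q j)) /=.
  by under eq_bigr do rewrite big_pred1_eq; rewrite -mulr_suml pp.2 mul1r.
Qed.

Lemma diamond_pow_neq0 m (X : set (formal_sum R m m)) n :
  listed X -> X !=set0 -> diamond_pow X n !=set0.
Proof.
move=> lX X0; rewrite /diamond_pow; elim: n.-1 => [|k IH] //=.
by apply: diamond_neq0 => //; case: (k) => [|k'] //=; exact: listed_diamond.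
Qed.

(** The given listing and the one that factors live on different spaces. Their formal sums agree, so
    coupling them costs probability 0, written as a bound so that it can be added to the others. *)
Lemma diamond_couple l m n (X : set (formal_sum R m n)) (Y : set (formal_sum R l m))
    Om (mu : Om -> R) E : prob mu -> diamond X Y (mix mu E) ->
  exists Om' (mu' : Om' -> R) (f : Om' -> Om) A B,
    [/\ prob mu', pushes mu' f mu, X (mix mu' A), Y (mix mu' B) &
        Pr mu' (fun w => E (f w) <> A w \o B w) <= 0].
Proof.
move=> pm /diamondE[I [p [A [B [pp XA YB eq]]]]].
have [r r0 [r1 r2]] := couple E (fun w => A w \o B w) pm pp.
rewrite -eq => le; exists (Om * I)%type, r, fst, (A \o snd), (B \o snd); split=> //.
- exact: prob_push r1 pm r0.
- by rewrite (mix_push _ r2).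
- by rewrite (mix_push _ r2).
- apply: le_trans le _; rewrite /sdist fsbig1 ?mulr0 // => F _.
  by rewrite subrr normr0.
Qed.

(** With [phi] the composition with the encoding, only encoded actions are close. The random channel
    [B] itself still lists an element of [Y], so it can enter a further correlated composition. *)
Lemma approx_couple k l m n (phi : superop R k l -> superop R m n)
    (X Y : set (formal_sum R k l)) eps Om (mu : Om -> R) A :
  approx_class [set termwise phi A | A in X] eps [set termwise phi A | A in Y] ->
  listed Y -> prob mu -> X (mix mu A) ->
  exists Om' (mu' : Om' -> R) (f : Om' -> Om) B,
    [/\ prob mu', pushes mu' f mu, Y (mix mu' B) &
        Pr mu' (fun w => phi (A (f w)) <> phi (B w)) <= eps].
Proof.
move=> XY lY pm XA; have [|_ [B YB <-]] := XY (termwise phi (mix mu A)).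
  by exists (mix mu A).
have [J [q [F [qq eB]]]] := lY _ YB; rewrite eB !termwise_mix => le.
have [r r0 [r1 r2 leP]] := couple (phi \o A) (phi \o F) pm qq.
exists (Om * J)%type, r, fst, (F \o snd); split=> //.
- exact: prob_push r1 pm r0.
- by rewrite (mix_push _ r2) -eB.
- exact: le_trans leP le.
Qed.

Lemma approx_couple_id m n (X Y : set (formal_sum R m n)) eps Om (mu : Om -> R) A :
  approx_class X eps Y -> listed Y -> prob mu -> X (mix mu A) ->
  exists Om' (mu' : Om' -> R) (f : Om' -> Om) B,
    [/\ prob mu', pushes mu' f mu, Y (mix mu' B) &
        Pr mu' (fun w => A (f w) <> B w) <= eps].
Proof.
move=> XY lY pm XA; have [B YB le] := XY _ XA.
have [J [q [F [qq eB]]]] := lY _ YB; rewrite eB in le.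
have [r r0 [r1 r2 leP]] := couple A F pm qq.
exists (Om * J)%type, r, fst, (F \o snd); split=> //.
- exact: prob_push r1 pm r0.
- by rewrite (mix_push _ r2) -eB.
- exact: le_trans leP le.
Qed.

Lemma gauge_couple (K : code_data R) I (p : I -> R)
    (X : I -> set (superop R (hdim K) (hdim K))) Om (mu : Om -> R) A :
  prob mu -> gauge_form p X (mix mu A) ->
  exists Om' (mu' : Om' -> R) (f : Om' -> Om) (l : Om' -> I) B,
    [/\ prob mu', pushes mu' f mu, forall i, p i = \sum_(w | l w == i) mu' w,
        forall w, X (l w) (B w) & Pr mu' (fun w => A (f w) <> B w) <= 0].
Proof.
move=> pm [J [l [q [F [qq pl XF eq]]]]].
have [r r0 [r1 r2]] := couple A F pm qq; rewrite -eq => le.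
exists (Om * J)%type, r, fst, (l \o snd), (F \o snd); split=> //.
- exact: prob_push r1 pm r0.
- move=> i; rewrite pl (partition_big snd (fun j => l j == i)) //=.
  apply: eq_bigr => j /eqP lj; rewrite -r2; apply: eq_bigl => w.
  by case: (w.2 =P j) => [->|]; rewrite ?andbF // lj eqxx.
- by move=> w; exact: XF.
- apply: le_trans le _; rewrite /sdist fsbig1 ?mulr0 // => B _.
  by rewrite subrr normr0.
Qed.

Lemma sfail_mix (K : code_data R) Om (mu : Om -> R) E : prob mu ->
  sfail (K := K) (mix mu E) =
    Pr mu (fun w => @Defs.decode R K \o E w \o @encode R K <> id).
Proof. by move=> pm; rewrite /sfail termwise_mix sdist_sone. Qed.

Lemma Pr_le_fail (K : code_data R) X Om (mu : Om -> R) E :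
  listed X -> prob mu -> X (mix mu E) ->
  Pr mu (fun w => @Defs.decode R K \o E w \o @encode R K <> id) <= fail (K := K) X.
Proof.
move=> lX pm XE; rewrite -sfail_mix //; apply: ub_le_sup; last by exists (mix mu E).
exists 1 => _ [A XA <-]; have [I [p [F [pp ->]]]] := lX _ XA.
by rewrite sfail_mix //; exact: Pr_le1.
Qed.

Lemma fail_le (K : code_data R) X d : listed X -> X !=set0 ->
  (forall Om (mu : Om -> R) E, prob mu -> X (mix mu E) ->
     Pr mu (fun w => @Defs.decode R K \o E w \o @encode R K <> id) <= d) ->
  fail (K := K) X <= d.
Proof.
move=> lX [A XA] le; apply: ge_sup; first by exists (sfail A), A.
move=> _ [B XB <-]; have [I [p [F [pp eB]]]] := lX _ XB.
by rewrite eB sfail_mix //; apply: le; rewrite // -eB.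
Qed.

Lemma noisy_layer l m n (C : superop R l m) (Rc : set (formal_sum R m n))
    (X : set (formal_sum R m m)) (N2 : set (formal_sum R m m)) N1 d1 d2
    Om (mu : Om -> R) F A :
  approx_class (class_comp X C) d2 (class_comp N2 C) ->
  approx_class (class_comp (diamond Rc N2) C) d1 (class_comp N1 C) ->
  listed N1 -> listed N2 -> prob mu -> Rc (mix mu F) -> X (mix mu A) ->
  exists Om' (mu' : Om' -> R) (f : Om' -> Om) M,
    [/\ prob mu', pushes mu' f mu, N1 (mix mu' M) &
        Pr mu' (fun w => F (f w) \o A (f w) \o C <> M w \o C) <= d1 + d2].
Proof.
move=> XN RN l1 l2 pm RF XA.
have [W1 [m1 [f1 [B [pm1 pf1 NB leB]]]]] := approx_couple XN l2 pm XA.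
have RB : diamond Rc N2 (mix m1 (fun w => F (f1 w) \o B w)).
  by apply: (diamond_mix (A := F \o f1)) => //; rewrite (mix_push _ pf1).
have [W2 [m2 [f2 [M [pm2 pf2 NM leM]]]]] := approx_couple RN l1 pm1 RB.
exists W2, m2, (f1 \o f2), M; split=> //; first exact: pushes_comp pf2 pf1.
rewrite -(Pr_push _ pf2) in leB; rewrite addrC.
apply: (Pr_union_le _ leB leM) => // w.
apply: contra_notP => /not_orP[/contrapT h1 /contrapT h2].
by rewrite -h2; exact: (congr1 (fun X => F (f1 (f2 w)) \o X) h1).
Qed.

(** The earliest rounds are innermost, so the induction hypothesis turns the tail [Y] into [N1],
    which the next layer of [L] turns into [N2] and the next recovery into [N1] again. The very
    first layer meets no residual noise, whence the separate hypothesis on [L] alone. *)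
Lemma memory_couple m l (C : superop R l m) (Rc L N1 N2 : set (formal_sum R m m))
    d1 d2 n Om (mu : Om -> R) Z :
  approx_class (class_comp L C) d2 (class_comp N2 C) ->
  approx_class (class_comp (diamond L N1) C) d2 (class_comp N2 C) ->
  approx_class (class_comp (diamond Rc N2) C) d1 (class_comp N1 C) ->
  listed N1 -> listed N2 -> prob mu -> diamond_pow (diamond Rc L) n.+1 (mix mu Z) ->
  exists Om' (mu' : Om' -> R) (f : Om' -> Om) M,
    [/\ prob mu', pushes mu' f mu, N1 (mix mu' M) &
        Pr mu' (fun w => Z (f w) \o C <> M w \o C) <= n.+1%:R * (d1 + d2)].
Proof.
move=> LN LNN RN l1 l2; elim: n => [|n IH] in Om mu Z * => pm XZ.
  have [W1 [m1 [f1 [F [B [pm1 pf1 RF LB le0]]]]]] := diamond_couple pm XZ.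
  have [W2 [m2 [f2 [M [pm2 pf2 NM leM]]]]] := noisy_layer LN RN l1 l2 pm1 RF LB.
  exists W2, m2, (f1 \o f2), M; split=> //; first exact: pushes_comp pf2 pf1.
  rewrite -(Pr_push _ pf2) in le0; rewrite mul1r -[leRHS]add0r.
  apply: (Pr_union_le _ le0 leM) => // w.
  apply: contra_notP => /not_orP[/contrapT h1 /contrapT h2].
  by rewrite -h2 -h1.
have [W1 [m1 [f1 [E [Y [pm1 pf1 XE XY le1]]]]]] := diamond_couple pm XZ.
have [W2 [m2 [f2 [F [B [pm2 pf2 RF LB le2]]]]]] := diamond_couple pm1 XE.
rewrite -(mix_push Y pf2) in XY.
have [W3 [m3 [f3 [M [pm3 pf3 NM le3]]]]] := IH _ _ _ pm2 XY.
have LM : diamond L N1 (mix m3 (fun w => B (f3 w) \o M w)).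
  by apply: (diamond_mix (A := B \o f3)) => //; rewrite (mix_push _ pf3).
rewrite -(mix_push F pf3) in RF.
have [W4 [m4 [f4 [M' [pm4 pf4 NM' le4]]]]] := noisy_layer LNN RN l1 l2 pm3 RF LM.
exists W4, m4, (f1 \o f2 \o f3 \o f4), M'; split=> //.
  exact: pushes_comp pf4 (pushes_comp pf3 (pushes_comp pf2 pf1)).
rewrite -(Pr_push _ pf4) in le3.
rewrite -(Pr_push _ (pushes_comp pf4 pf3)) in le2.
rewrite -(Pr_push _ (pushes_comp (pushes_comp pf4 pf3) pf2)) in le1.
rewrite -[n.+2]add1n natrD mulrDl mul1r.
(* Two zero terms make room for the null events of [le1] and [le2]. *)
rewrite -[leRHS]add0r.
rewrite -[leRHS]add0r.
apply: (Pr_union_le pm4 le1 (Pr_union_le pm4 le2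
  (Pr_union_le pm4 le4 le3 (fun _ => id)) (fun _ => id))) => w.
apply: contra_notP => /not_orP[/contrapT h1 /not_orP[/contrapT h2
  /not_orP[/contrapT h3 /contrapT h4]]].
rewrite -h3; transitivity (F (f3 (f4 w)) \o B (f3 (f4 w)) \o (Y (f2 (f3 (f4 w))) \o C)).
  by rewrite h1 h2.
exact: (congr1 (fun X => F (f3 (f4 w)) \o B (f3 (f4 w)) \o X) h4).
Qed.

Lemma memory_fail (K : code_data R) (Rc L N1 N2 : set (formal_sum R (hdim K) (hdim K)))
    d1 d2 d3 n :
  approx_class (class_comp L (@encode R K)) d2 (class_comp N2 (@encode R K)) ->
  approx_class (class_comp (diamond L N1) (@encode R K)) d2
    (class_comp N2 (@encode R K)) ->
  approx_class (class_comp (diamond Rc N2) (@encode R K)) d1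
    (class_comp N1 (@encode R K)) ->
  fail N1 <= d3 -> listed N1 -> listed N2 -> listed Rc -> listed L ->
  Rc !=set0 -> L !=set0 -> (1 <= n)%N ->
  fail (diamond_pow (diamond Rc L) n) <= n%:R * (d1 + d2) + d3.
Proof.
move=> LN LNN RN N3 l1 l2 lR lL R0 L0; case: n => // n _.
apply: fail_le.
- by apply: listed_diamond_pow; exact: listed_diamond.
- by apply: diamond_pow_neq0; [exact: listed_diamond | exact: diamond_neq0].
move=> Om mu Z pm XZ.
have [W1 [m1 [f1 [M [pm1 pf1 NM le1]]]]] := memory_couple LN LNN RN l1 l2 pm XZ.
rewrite -(Pr_push _ pf1).
apply: (Pr_union_le pm1 le1 (le_trans (Pr_le_fail l1 pm1 NM) N3)) => w.
apply: contra_notP => /not_orP[/contrapT h1 /contrapT h2].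
by rewrite -h2; exact: (congr1 (fun X => Defs.decode (K := K) \o X) h1).
Qed.

End Classes.

(** * Linear algebra *)
Section Adjoint.
Context {R : realType}.
Local Notation C := R[i].

Lemma adjmxM m n p (A : 'M[C]_(m, n)) (B : 'M[C]_(n, p)) :
  adjmx (A *m B) = adjmx B *m adjmx A.
Proof. by rewrite /adjmx map_mxM trmx_mul. Qed.

Lemma adjmxK m n (A : 'M[C]_(m, n)) : adjmx (adjmx A) = A.
Proof. by apply/matrixP => i j; rewrite !mxE conjCK. Qed.

Lemma adjmxD m n (A B : 'M[C]_(m, n)) : adjmx (A + B) = adjmx A + adjmx B.
Proof. by apply/matrixP => i j; rewrite !mxE rmorphD. Qed.

Lemma adjmxB m n (A B : 'M[C]_(m, n)) : adjmx (A - B) = adjmx A - adjmx B.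
Proof. by apply/matrixP => i j; rewrite !mxE rmorphB. Qed.

Lemma adjmxZ m n c (A : 'M[C]_(m, n)) : adjmx (c *: A) = c^* *: adjmx A.
Proof. by apply/matrixP => i j; rewrite !mxE rmorphM. Qed.

Lemma adjmx1 n : adjmx 1%:M = 1%:M :> 'M[C]_n.
Proof. by rewrite /adjmx map_mx1 trmx1. Qed.

Lemma adjmx_tens m n p q (A : 'M[C]_(m, n)) (B : 'M[C]_(p, q)) :
  adjmx (A *t B) = adjmx A *t adjmx B.
Proof. by rewrite /adjmx map_mxT trmx_tens. Qed.

Lemma conj_phase m n (c : C) (A : 'M[C]_(m, n)) (X : 'M[C]_n) : c * c^* = 1 ->
  (c *: A) *m X *m adjmx (c *: A) = A *m X *m adjmx A.
Proof.
by move=> c1; rewrite adjmxZ -!scalemxAl -scalemxAr scalerA c1 scale1r.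
Qed.

End Adjoint.

(** * Positive forms and their null vectors *)

Section PositiveForms.
Context {R : realType}.
Local Notation C := R[i].

Definition psd {n} (A : 'M[C]_n) : Prop :=
  forall v : 'cV[C]_n, 0 <= (adjmx v *m A *m v) 0 0.

Lemma squeeze0 (c d : C) : 0 <= d ->
  (forall r, 0 < r -> 0 <= c + r * d) -> (forall r, 0 < r -> 0 <= - c + r * d) -> c = 0.
Proof.
move=> d0 h1 h2; have d1 : 0 < 1 + d by rewrite ltr_pwDl.
have cr : c \is Num.real.
  have := h1 1 ltr01; rewrite mul1r => /ger0_real.
  by rewrite rpredDr // ger0_real.
apply/eqP; rewrite -normr_eq0; apply/negP => /negP n0.
have np : 0 < `|c| by rewrite lt_def n0 normr_ge0.
(* For this [r], the bound [|c| <= r * d] would give [1 + d <= d]. *)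
pose r := `|c| / (1 + d).
have r0 : 0 < r by rewrite divr_gt0.
have : `|c| <= r * d.
  rewrite real_ler_norml //; have := h1 r r0; have := h2 r r0.
  rewrite [- c + _]addrC subr_ge0 => -> /=.
  by rewrite -lerBlDr sub0r => ->.
rewrite /r mulrAC ler_pdivlMr // ler_pM2l // gerDr.
by rewrite ler10.
Qed.

(** First variation at [v]: letting [z] be a small multiple of a phase forces the linear term to
    vanish. As [psd] speaks of quadratic values only, [a] and [b] are two unknowns, which the phases
    1 and ['i] separate. *)
Lemma psd_null n (A : 'M[C]_n) (v : 'cV[C]_n) :
  psd A -> (adjmx v *m A *m v) 0 0 = 0 -> adjmx v *m A = 0.
Proof.
move=> pA v0; suff H (u : 'cV[C]_n) : (adjmx v *m A *m u) 0 0 = 0.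
  by apply/rowP => j; have := H (delta_mx j 0); rewrite -colE mxE => ->; rewrite mxE.
set a := (X in X = 0); pose b := (adjmx u *m A *m v) 0 0.
pose d := (adjmx u *m A *m u) 0 0.
have d0 : 0 <= d by exact: pA.
have eD (X Y : 'M[C]_1) : (X + Y) 0 0 = X 0 0 + Y 0 0 by rewrite mxE.
have eZ (z : C) (X : 'M[C]_1) : (z *: X) 0 0 = z * X 0 0 by rewrite mxE.
have f z : 0 <= z * a + z^* * b + z^* * z * d.
  have := pA (v + z *: u); rewrite adjmxD adjmxZ !mulmxDl !mulmxDr.
  rewrite -!scalemxAl -!scalemxAr !eD !eZ v0 -/a -/b -/d; congr (0 <= _); ring.
have lin z : z * z^* = 1 -> z * a + z^* * b = 0.
  move=> z1; apply: (squeeze0 d0) => r r0.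
    have rc : r^* = r by rewrite geC0_conj // ltW.
    have := f (r * z); rewrite rmorphM /= rc.
    have -> : r * z * a + r * z^* * b + r * z^* * (r * z) * d =
      r * (z * a + z^* * b + r * (z * z^*) * d) by ring.
    by rewrite z1 mulr1 pmulr_rge0.
  have rc : r^* = r by rewrite geC0_conj // ltW.
  have := f (- r * z); rewrite rmorphM rmorphN /= rc.
  have -> : - r * z * a + - r * z^* * b + - r * z^* * (- r * z) * d =
    r * (- (z * a + z^* * b) + r * (z * z^*) * d) by ring.
  by rewrite z1 mulr1 pmulr_rge0.
have e1 : a + b = 0 by have := lin 1; rewrite conjC1 !mul1r; apply.
have e2 : 'i * (a - b) = 0.
  have := lin 'i; rewrite conjCi => h; rewrite -[RHS]h; first by ring.
  by rewrite mulrN -expr2 sqrCi opprK.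
move/eqP: e2; rewrite mulf_eq0 (negPf (neq0Ci _)) /= subr_eq0 => /eqP ab.
move/eqP: e1; rewrite -ab -mulr2n mulrn_eq0 /= => /eqP //.
Qed.

Lemma psd_tr_null m n (A : 'M[C]_n) (X : 'M[C]_(m, n)) :
  psd A -> \tr (X *m A *m adjmx X) = 0 -> X *m A = 0.
Proof.
move=> pA t0; have e i : (X *m A *m adjmx X) i i =
    (adjmx (adjmx (row i X)) *m A *m adjmx (row i X)) 0 0.
  rewrite adjmxK -[in RHS]row_mul !mxE; apply: eq_bigr => j _.
  by rewrite !mxE.
have z i : (X *m A *m adjmx X) i i = 0.
  have /eqP := t0; rewrite /mxtrace psumr_eq0; last by move=> k _; rewrite e; exact: pA.
  by move=> /allP/(_ i (mem_index_enum i))/eqP.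
apply/row_matrixP => i; rewrite row_mul row0 -[row i X]adjmxK.
by apply: psd_null; rewrite // -e.
Qed.

End PositiveForms.

(** * Operators on a tensor product as block matrices *)

Section Blocks.
Context {R : realType} {d g : nat}.
Local Notation C := R[i].
Implicit Types X Y V : 'M[C]_(d * g).

Definition blk X (a b : 'I_d) : 'M[C]_g :=
  \matrix_(k, l) X (mxtens_index (a, k)) (mxtens_index (b, l)).

Lemma blkP X Y : (forall a b, blk X a b = blk Y a b) -> X = Y.
Proof.
move=> XY; apply/matrixP => i j; case: (mxtens_indexP i) => a k.
by case: (mxtens_indexP j) => b l; have /matrixP/(_ k l) := XY a b; rewrite !mxE.
Qed.

Lemma sum_tens_index (F : 'I_(d * g) -> C) :
  \sum_i F i = \sum_a \sum_k F (mxtens_index (a, k)).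
Proof.
rewrite pair_bigA /= (reindex (@mxtens_index d g)) /=; first by apply: eq_bigr => -[].
by exists (@mxtens_unindex d g) => i _; rewrite (mxtens_indexK, mxtens_unindexK).
Qed.

Lemma blkM X Y a b : blk (X *m Y) a b = \sum_c blk X a c *m blk Y c b.
Proof.
apply/matrixP => k l; rewrite summxE !mxE sum_tens_index; apply: eq_bigr => c _.
by rewrite mxE; apply: eq_bigr => j _; rewrite !mxE.
Qed.

Lemma blk_tens (A : 'M[C]_d) (B : 'M[C]_g) a b : blk (A *t B) a b = A a b *: B.
Proof. by apply/matrixP => k l; rewrite mxE tensmxE mxE. Qed.

Lemma blk_adj X a b : blk (adjmx X) a b = adjmx (blk X b a).
Proof. by apply/matrixP => k l; rewrite !mxE. Qed.

Lemma ptraceE X a b : ptrace X a b = \tr (blk X a b).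
Proof. by rewrite mxE; apply: eq_bigr => k _; rewrite mxE. Qed.

Lemma tens1_inj (A B : 'M[C]_g) : (0 < d)%N ->
  1%:M *t A = 1%:M *t B :> 'M[C]_(d * g) -> A = B.
Proof.
move=> d0 /(congr1 (fun X => blk X (Ordinal d0) (Ordinal d0))).
by rewrite !blk_tens mxE eqxx !scale1r.
Qed.

Lemma tens1M (A B : 'M[C]_g) :
  (1%:M *t A) *m (1%:M *t B) = 1%:M *t (A *m B) :> 'M[C]_(d * g).
Proof. by rewrite tensmx_mul mul1mx. Qed.

Lemma tens11 : 1%:M *t 1%:M = 1%:M :> 'M[C]_(d * g).
Proof.
apply: blkP => a b; rewrite blk_tens; apply/matrixP => k l; rewrite !mxE.
by rewrite (can_eq (@mxtens_indexK d g)) xpair_eqE -natrM mulnb.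
Qed.

Lemma tens1D (A B : 'M[C]_g) :
  1%:M *t (A + B) = 1%:M *t A + 1%:M *t B :> 'M[C]_(d * g).
Proof. by apply/matrixP => i j; rewrite !mxE mulrDr. Qed.

Lemma tens1Z c (A : 'M[C]_g) : 1%:M *t (c *: A) = c *: (1%:M *t A) :> 'M[C]_(d * g).
Proof. by apply/matrixP => i j; rewrite !mxE mulrCA. Qed.

Lemma tens1_sum I (s : seq I) (F : I -> 'M[C]_g) :
  1%:M *t (\sum_(i <- s) F i) = \sum_(i <- s) 1%:M *t F i :> 'M[C]_(d * g).
Proof.
elim: s => [|x s IH]; first by rewrite !big_nil tensmx0.
by rewrite !big_cons tens1D IH.
Qed.

(* [\tr (X *m tau *m adjmx Y)] is a semi-inner product.  The hypothesis on the
   reduced channel says that off-diagonal blocks of [V] have norm zero and that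
   the diagonal ones are at distance zero from each other. *)
Lemma logical_identity (V : 'M[C]_(d * g)) (tau : 'M[C]_g) : (0 < d)%N -> psd tau ->
  (forall rho : 'M[C]_d, ptrace (V *m (rho *t tau) *m adjmx V) = rho) ->
  exists b, V *m (1%:M *t tau) = 1%:M *t b.
Proof.
move=> d0 pt idV; pose o := Ordinal d0.
(* Matrix units as inputs yield all inner products between blocks of [V]. *)
have dot a b c c' : \tr (blk V a c *m tau *m adjmx (blk V b c')) =
    (a == c)%:R * (b == c')%:R.
  have /matrixP/(_ a b) := idV (delta_mx c c').
  rewrite ptraceE blkM mxE -natrM mulnb => <-; congr (\tr _).
  under [RHS]eq_bigr do rewrite blkM blk_adj.
  rewrite (bigD1 c') //= [X in _ + X]big1 ?addr0; last first.
    move=> e ec; rewrite big1 ?mul0mx // => e' _.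
    by rewrite blk_tens mxE (negPf ec) andbF scale0r mulmx0.
  rewrite (bigD1 c) //= [X in _ + X]big1 ?addr0; last first.
    by move=> e ec; rewrite blk_tens mxE (negPf ec) scale0r mulmx0.
  by rewrite blk_tens mxE !eqxx scale1r.
have off a c : a != c -> blk V a c *m tau = 0.
  by move=> /negPf ac; apply: psd_tr_null; rewrite // dot ac mul0r.
have trB (X Y : 'M[C]_g) : \tr (X - Y) = \tr X - \tr Y by exact: raddfB.
have expand (X Y : 'M[C]_g) : \tr ((X - Y) *m tau *m adjmx (X - Y)) =
    \tr (X *m tau *m adjmx X) - \tr (Y *m tau *m adjmx X) -
    (\tr (X *m tau *m adjmx Y) - \tr (Y *m tau *m adjmx Y)).
  rewrite adjmxB mulmxBr trB mulmxBl.
  rewrite [(_ - _) *m adjmx X]mulmxBl [(_ - _) *m adjmx Y]mulmxBl.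
  by congr (_ - _); exact: trB.
have diag a : blk V a a *m tau = blk V o o *m tau.
  apply/eqP; rewrite -subr_eq0 -mulmxBl; apply/eqP/psd_tr_null => //.
  by rewrite expand !dot !eqxx !subrr.
exists (blk V o o *m tau); apply: blkP => a b.
rewrite blk_tens blkM (bigD1 b) //= [X in _ + X]big1 ?addr0; last first.
  by move=> c cb; rewrite blk_tens mxE (negPf cb) scale0r mulmx0.
rewrite blk_tens !mxE eqxx scale1r; have [->|ab] := eqVneq a b.
  by rewrite scale1r diag.
by rewrite off // scale0r.
Qed.

(* [tau] generates the full matrix algebra as a two-sided ideal. *)
Lemma normalizer_tens (V : 'M[C]_(d * g)) (tau b : 'M[C]_g) : tau != 0 ->
  V *m (1%:M *t tau) = 1%:M *t b ->
  (forall a, exists a', V *m (1%:M *t a) = (1%:M *t a') *m V) ->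
  exists B, V = 1%:M *t B.
Proof.
move=> /eqP t0 Vt nV.
have [k [l tkl]] : exists k l, tau k l != 0.
  apply: contra_notP t0 => h; apply/matrixP => k l; rewrite mxE.
  by apply/eqP; apply: contra_notT h => h; exists k, l.
pose t : C := tau k l.
have one : 1%:M = \sum_i t^-1 *: (delta_mx i k *m tau *m delta_mx l i) :> 'M[C]_g.
  have sandwich i : delta_mx i k *m tau *m delta_mx l i = t *: delta_mx i i.
    apply/matrixP => x y; rewrite mxE (bigD1 l) //= big1 ?addr0; last first.
      by move=> z /negPf zl; rewrite [delta_mx l i _ _]mxE zl mulr0.
    rewrite mxE (bigD1 k) //= big1 ?addr0; last first.
      by move=> z /negPf zk; rewrite mxE zk andbF mul0r.
    by rewrite !mxE !eqxx andbT mulrAC mulrC -natrM mulnb.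
  under eq_bigr do rewrite sandwich scalerA mulVf // scale1r.
  by rewrite [LHS]matrix_sum_delta; apply/matrixP => x y; rewrite !summxE;
     apply: eq_bigr => i _; rewrite summxE (bigD1 i) //= big1 ?addr0 => [|j /negPf ji];
     rewrite !mxE ?eqxx ?mul1r // eq_sym ji mul0r.
pose f a := projT1 (cid (nV a)).
have fE a : V *m (1%:M *t a) = (1%:M *t f a) *m V by exact: projT2 (cid (nV a)).
(* In each term [V] moves past [delta_mx i k], turning it into its image under [f], and then meets
   [tau], where the product with [V] is [b]. *)
exists (\sum_i t^-1 *: (f (delta_mx i k) *m b *m delta_mx l i)).
rewrite -[LHS]mulmx1 -tens11 {1}one !tens1_sum mulmx_sumr; apply: eq_bigr => i _.
by rewrite !tens1Z -scalemxAr -!tens1M mulmxA mulmxA fE -[_ *m V *m _]mulmxA Vt.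
Qed.
End Blocks.

(** * Pauli operators *)

Section Pauli.
Context {R : realType}.
Local Notation C := R[i].

Definition anti1 (P P' : pauli1) : bool :=
  match P, P' with
  | PI, _ | _, PI | PX, PX | PY, PY | PZ, PZ => false
  | _, _ => true
  end.

Definition anticomm {Q : finType} (e f : pauli Q) : bool :=
  \big[addb/false]_q anti1 (e q) (f q).

(** The sum over intermediate basis states factors over the qubits, which reduces identities between
    Pauli operators to one qubit. *)
Lemma pauli_mxM (Q : finType) (e f : pauli Q) a b :
  (pauli_mx e *m pauli_mx f : 'M[C]_(qdim Q)) a b =
  \prod_q \sum_(c : bool) pauli1_entry (e q) ((enum_val a : {ffun Q -> bool}) q) c *
            pauli1_entry (f q) c ((enum_val b : {ffun Q -> bool}) q).
Proof.
rewrite bigA_distr_bigA /= mxE (reindex_onto enum_rank enum_val) /=; last first.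
  by move=> i _; exact: enum_valK.
apply: eq_big => c; first by rewrite enum_rankK eqxx.
by move=> _; rewrite !mxE -big_split; apply: eq_bigr => q _; rewrite enum_rankK.
Qed.

Lemma pauli1_comm (P P' : pauli1) (a b : bool) :
  \sum_(c : bool) pauli1_entry P a c * pauli1_entry P' c b =
  (-1) ^+ anti1 P P' * \sum_(c : bool) pauli1_entry P' a c * pauli1_entry P c b :> C.
Proof.
rewrite !big_bool; case: P; case: P'; case: a; case: b => /=; ring.
Qed.

Lemma pauli_mx_comm (Q : finType) (e f : pauli Q) :
  pauli_mx e *m pauli_mx f =
  (-1) ^+ anticomm e f *: (pauli_mx f *m pauli_mx e) :> 'M[C]_(qdim Q).
Proof.
apply/matrixP => a b; rewrite [RHS]mxE !pauli_mxM.
under eq_bigr do rewrite pauli1_comm.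
rewrite big_split /= /anticomm; congr (_ * _).
by elim/big_rec2: _ => [|q x y _ ->] //; rewrite signr_addb.
Qed.

Lemma prod_eq_enum_val (Q : finType) (a b : 'I_(qdim Q)) :
  \prod_q ((enum_val a : {ffun Q -> bool}) q ==
           (enum_val b : {ffun Q -> bool}) q)%:R = (a == b)%:R :> C.
Proof.
have [->|ab] := eqVneq a b; first by rewrite big1 // => q _; rewrite eqxx.
have nab : enum_val a <> enum_val b by move/enum_val_inj => eab; rewrite eab eqxx in ab.
have [q qab] : exists q, (enum_val a : {ffun Q -> bool}) q !=
    (enum_val b : {ffun Q -> bool}) q.
  apply: contra_notP nab => h; apply/ffunP => q; apply/eqP.
  by apply: contra_notT h => h; exists q.
by rewrite (bigD1 q) //= (negPf qab) mul0r.
Qed.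

Lemma pauli_mx_sq (Q : finType) (e : pauli Q) :
  pauli_mx e *m pauli_mx e = 1%:M :> 'M[C]_(qdim Q).
Proof.
apply/matrixP => a b; rewrite pauli_mxM mxE.
have i2 : 'i * 'i = -1 :> C by rewrite -expr2 sqrCi.
have sq P (x y : bool) :
    \sum_c pauli1_entry P x c * pauli1_entry P c y = (x == y)%:R :> C.
  rewrite big_bool; case: P; case: x; case: y => /=; rewrite ?(mulNr, mulrN) ?i2; ring.

under eq_bigr do rewrite sq.
exact: prod_eq_enum_val.
Qed.

Lemma pauli_mx_adj (Q : finType) (e : pauli Q) :
  adjmx (pauli_mx e) = pauli_mx e :> 'M[C]_(qdim Q).
Proof.
apply/matrixP => a b; rewrite !mxE rmorph_prod; apply: eq_bigr => q _.
case: (e q) => /=; rewrite ?conjC_nat ?[_ == enum_val b q]eq_sym //.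
- case: eqP => [_|]; rewrite ?conjC0 //; case: ifP => //; case: ifP;
    by rewrite ?rmorphN /= ?conjCi ?opprK.
- by case: eqP => [->|]; rewrite ?conjC0 // rmorphXn rmorphN1.
Qed.

End Pauli.

(** * Code spaces and the gauge algebra *)
Section SymmetricDifference.
Context {T : finType}.
Implicit Types x y z : {set T}.

Lemma in_add2 x y c : (c \in add2 x y) = (c \in x) (+) (c \in y).
Proof. by rewrite !inE; case: (c \in x); case: (c \in y). Qed.

Lemma add2C x y : add2 x y = add2 y x.
Proof. by apply/setP => c; rewrite !in_add2 addbC. Qed.

Lemma add2A x y z : add2 x (add2 y z) = add2 (add2 x y) z.
Proof. by apply/setP => c; rewrite !in_add2 addbA. Qed.

Lemma add2xx x : add2 x x = finset.set0.
Proof. by apply/setP => c; rewrite !in_add2 addbb inE. Qed.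

Lemma add20 x : add2 x finset.set0 = x.
Proof. by apply/setP => c; rewrite !in_add2 inE addbF. Qed.

End SymmetricDifference.

Section CodeSpaces.
Context {R : realType} {K : code_data R}.
Local Notation C := R[i].
Local Notation H := 'M[C]_(hdim K).
Local Notation pm e := (@pauli_mx R (qubit K) e : H).
Implicit Types (s t : {set check K}) (e : pauli (qubit K)).

(** The checks whose eigenvalue [e] flips: on code states, the syndrome that the error leaves. *)
Definition psynd e : {set check K} := [set c | anticomm e (check_op c)].

Lemma prod_intertwine n I (r : seq I) (A : 'M[C]_n) (f h : I -> 'M[C]_n) :
  (forall c, A *m f c = h c *m A) ->
  A *m (\prod_(c <- r) f c) = (\prod_(c <- r) h c) *m A.
Proof.
move=> fh; elim: r => [|c r IH]; first by rewrite !big_nil mulmx1 mul1mx.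
by rewrite !big_cons -!mulmxE mulmxA fh -mulmxA IH mulmxA.
Qed.

Lemma pauli_proj e s : pm e *m synd_proj s = synd_proj (add2 s (psynd e)) *m pm e.
Proof.
apply: prod_intertwine => c; rewrite -scalemxAr -scalemxAl; congr (_ *: _).
rewrite mulmxDr mulmxDl mulmx1 mul1mx; congr (_ + _).
rewrite -scalemxAr -scalemxAl pauli_mx_comm scalerA; congr (_ *: _).
by rewrite -signr_addb in_add2 inE addbA.
Qed.

Context (K_code : is_code K).

(** The check commutes past the other factors of the projector until its own factor absorbs it up to
    the sign. *)
Lemma check_proj c s :
  pm (check_op c) *m synd_proj s = (-1) ^+ (check_val c (+) (c \in s)) *: synd_proj s.
Proof.
pose f c : H :=
  2^-1 *: (1%:M + (-1) ^+ (check_val c (+) (c \in s)) *: pm (check_op c)).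
rewrite (_ : synd_proj s = \prod_c f c) //.
have cin : c \in index_enum (check K) by exact: mem_index_enum.
elim: (index_enum _) cin => [//|d r IH]; rewrite inE => cin.
rewrite big_cons -mulmxE mulmxA.
have [cd|/negPf ncd] := eqVneq c d.
  rewrite -cd; have -> : pm (check_op c) *m f c =
      (-1) ^+ (check_val c (+) (c \in s)) *: f c; last by rewrite scalemxAl.
  rewrite /f -scalemxAr mulmxDr mulmx1 -scalemxAr pauli_mx_sq.
  rewrite [RHS]scalerA mulrC -[RHS]scalerA; congr (_ *: _).
  by rewrite scalerDr scalerA -expr2 sqrr_sign scale1r addrC.
have cf : pm (check_op c) *m f d = f d *m pm (check_op c).
  rewrite /f -scalemxAr -scalemxAl mulmxDr mulmxDl mulmx1 mul1mx -scalemxAr -scalemxAl.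
  by rewrite (check_comm K_code c d).
by rewrite cf -mulmxA IH ?scalemxAr //; move: cin; rewrite ncd.
Qed.

Lemma synd_proj_sq s : is_syndrome s -> synd_proj s *m synd_proj s = synd_proj s.
Proof.
move=> /(synd_decomposition K_code)[W [WW <- _ _]].
by rewrite mulmxA -[X in X *m _]mulmxA WW mulmx1.
Qed.

Lemma synd_proj_adj s : is_syndrome s -> adjmx (synd_proj s) = synd_proj s.
Proof.
by move=> /(synd_decomposition K_code)[W [WW <- _ _]]; rewrite adjmxM adjmxK.
Qed.

(** A check on which [s] and [t] differ, placed between the two projectors, acts with both signs at
    once. *)
Lemma synd_proj_ortho s t : is_syndrome s -> s <> t -> synd_proj s *m synd_proj t = 0.
Proof.
move=> ss st; have [c cst] : exists c, (c \in s) != (c \in t).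
  apply: contra_notP st => h; apply/setP => c; apply/eqP.
  by apply: contra_notT h => h; exists c.
have e := check_proj c s; have := congr1 adjmx e.
rewrite adjmxM adjmxZ synd_proj_adj // pauli_mx_adj => e'.
have := congr1 (fun X => X *m synd_proj t) e'.
rewrite -mulmxA check_proj -scalemxAl -scalemxAr rmorphXn rmorphN1 => /eqP.
rewrite -subr_eq0 -scalerBl scaler_eq0 => /orP[|/eqP //].
move: cst; case: (c \in s); case: (c \in t) => // _; case: (check_val c);
  rewrite /= expr0 expr1 ?opprK -?opprD ?oppr_eq0 -[1 + 1](natrD _ 1 1) pnatr_eq0 //.
Qed.

Lemma emb_iso : adjmx (emb K) *m emb K = 1%:M.
Proof. by have [] := emb_decomposition K_code. Qed.

Lemma emb_proj : emb K *m adjmx (emb K) = synd_proj finset.set0.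
Proof. by have [] := emb_decomposition K_code. Qed.

Lemma proj_emb : synd_proj finset.set0 *m emb K = emb K.
Proof. by rewrite -emb_proj -mulmxA emb_iso mulmx1. Qed.

Lemma is_syndrome0 : is_syndrome (finset.set0 : {set check K}).
Proof.
apply/eqP => p0; have := emb_iso; rewrite -proj_emb p0 mul0mx mulmx0 => /esym/eqP.
have dg : (0 < ldim K * gdim K)%N by rewrite muln_gt0 (ldim_gt0 K_code) (gdim_gt0 K_code).
apply/negP; apply/eqP => /matrixP/(_ (Ordinal dg) (Ordinal dg)).
by rewrite !mxE eqxx => /eqP; rewrite oner_eq0.
Qed.

Lemma pauliK e n (A : 'M[C]_(hdim K, n)) : pm e *m (pm e *m A) = A.
Proof. by rewrite mulmxA pauli_mx_sq mul1mx. Qed.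

Lemma is_syndrome_add s e : is_syndrome s -> is_syndrome (add2 s (psynd e)).
Proof.
apply: contra => /eqP p0; rewrite -[synd_proj s](pauliK e) pauli_proj p0.
by rewrite mul0mx mulmx0.
Qed.

(** At the identity matrix, [corrP] equates the projectors of [add2 s (psynd (corr s))] and of the
    empty syndrome; orthogonality then identifies the labels. *)
Lemma corr_psynd s : is_syndrome s -> psynd (corr s) = s.
Proof.
move=> ss; have /(congr1 (fun F => F 1%:M)) := corrP K_code ss.
rewrite /= /pauli_op /synd_op !mulmx1 pauli_mx_adj synd_proj_sq //.
rewrite pauli_proj -[X in X = _]mulmxA !pauli_mx_sq !mulmx1.
rewrite synd_proj_sq ?is_syndrome0 // => e.
have st : is_syndrome (add2 s (psynd (corr s))) by exact: is_syndrome_add.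
have : add2 s (psynd (corr s)) = finset.set0.
  apply: contrapT => /(synd_proj_ortho st); rewrite e synd_proj_sq ?is_syndrome0 //.
  by move/eqP; apply/negP; exact: is_syndrome0.
by move=> /(congr1 (add2 s)); rewrite add2A add2xx add2C !add20.
Qed.

End CodeSpaces.

Lemma channel_with_fin {R : realType} {m n} (S : set 'M[R[i]]_(n, m)) (J : finType)
    (A : J -> 'M[R[i]]_(n, m)) :
  (forall j, S (A j)) -> \sum_j adjmx (A j) *m A j = 1%:M ->
  channel_with S (fun rho => \sum_j A j *m rho *m adjmx (A j)).
Proof.
move=> SA A1; exists #|J|, (fun i => A (enum_val i)); split=> //.
  by rewrite -[RHS]A1 [RHS](reindex (@enum_val J J)) //; exact: onW_bij (@enum_val_bij J).
apply/funext => rho; rewrite (reindex (@enum_val J J)) //.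
exact: onW_bij (@enum_val_bij J).
Qed.

Lemma central_mx_scalar {F : fieldType} {n} (A : 'M[F]_n) :
  (forall B, A *m B = B *m A) -> exists z, A = z%:M.
Proof.
case: n A => [|n] A cA; first by exists 0; apply/matrixP => -[].
exists (A 0 0); apply/matrixP => i j.
have /matrixP/(_ i 0) := cA (delta_mx j 0).
rewrite mxE (bigD1 j) //= big1 ?addr0; last first.
  by move=> k /negPf kj; rewrite mxE kj mulr0.
rewrite !mxE (bigD1 0) //= big1 ?addr0; last first.
  by move=> k /negPf kj; rewrite mxE kj andbF mul0r.
by rewrite !mxE !eqxx andbT mulr1 => ->; case: eqP; rewrite ?mul1r ?mul0r.
Qed.

(** * Gauge words and gauge channels *)

Section GaugeAlgebra.
Context {R : realType} {K : code_data R}.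
Local Notation C := R[i].
Local Notation H := 'M[C]_(hdim K).
Local Notation pm e := (@pauli_mx R (qubit K) e : H).
Local Notation U := (emb K).
Implicit Types (s t : {set check K}) (e : pauli (qubit K)).

(** Conjugation by a Pauli operator changes each generator by a sign at most. Gauge channels can
    therefore be moved through Pauli operations. *)
Lemma gauge_alg_conj e (A : H) : gauge_alg A -> gauge_alg (pm e *m A *m pm e).
Proof.
elim=> [j||B B' _ IH _ IH'|z B _ IH|B B' _ IH _ IH'].
- rewrite pauli_mx_comm -scalemxAl -mulmxA pauli_mx_sq mulmx1.
  exact/gauge_algZ/gauge_alg_gen.
- by rewrite mulmx1 pauli_mx_sq; exact: gauge_alg1.
- by rewrite mulmxDr mulmxDl; exact: gauge_algD.
- by rewrite -scalemxAr -scalemxAl; exact: gauge_algZ.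
- suff -> : pm e *m (B *m B') *m pm e = (pm e *m B *m pm e) *m (pm e *m B' *m pm e).
    exact: gauge_algM.
  by rewrite -!mulmxA [X in _ = _ *m (_ *m X)]pauliK.
Qed.

Lemma gauge_alg_pauli e (A : H) : gauge_alg A ->
  exists2 B, gauge_alg B & pm e *m A = B *m pm e.
Proof.
move=> gA; exists (pm e *m A *m pm e); first exact: gauge_alg_conj.
by rewrite -mulmxA pauli_mx_sq mulmx1.
Qed.

Lemma gauge_channel_id : @gauge_channel R K id.
Proof.
have := @channel_with_fin R _ _ (@gauge_alg R K) unit (fun=> 1%:M).
rewrite (_ : (fun rho => _) = id).
  apply=> [_|]; first exact: gauge_alg1.
  by rewrite (big_pred1 tt) ?adjmx1 ?mulmx1 // => -[].
by apply/funext => rho; rewrite (big_pred1 tt) ?adjmx1 ?mulmx1 ?mul1mx // => -[].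
Qed.

Lemma gauge_channel_unitary (A : H) : gauge_alg A -> adjmx A *m A = 1%:M ->
  gauge_channel (fun rho => A *m rho *m adjmx A).
Proof.
move=> gA A1; have := @channel_with_fin R _ _ (@gauge_alg R K) unit (fun=> A).
rewrite (_ : (fun rho => _) = (fun rho => A *m rho *m adjmx A)).
  by apply=> [_|] //; rewrite (big_pred1 tt) // => -[].
by apply/funext => rho; rewrite (big_pred1 tt) // => -[].
Qed.

Lemma gauge_channel_comp (G G' : superop R (hdim K) (hdim K)) :
  gauge_channel G -> gauge_channel G' -> gauge_channel (G \o G').
Proof.
move=> [k [A [gA A1 ->]]] [k' [A' [gA' A'1 ->]]].
have := @channel_with_fin R _ _ (@gauge_alg R K) ('I_k * 'I_k')%type
  (fun j => A j.1 *m A' j.2).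
rewrite (_ : (fun rho => \sum_j A j.1 *m A' j.2 *m rho *m adjmx (A j.1 *m A' j.2)) =
  (fun rho => \sum_j A j *m rho *m adjmx (A j)) \o
  (fun rho => \sum_j A' j *m rho *m adjmx (A' j))); last first.
  apply/funext => rho /=.
  rewrite -(pair_bigA _ (fun i j => A i *m A' j *m rho *m adjmx (A i *m A' j))) /=.
  apply: eq_bigr => i _; rewrite mulmx_sumr mulmx_suml; apply: eq_bigr => j _.
  by rewrite adjmxM !mulmxA.
apply=> [j|]; first exact: gauge_algM.
rewrite -(pair_bigA _ (fun i j => adjmx (A i *m A' j) *m (A i *m A' j))) /= exchange_big /=.
rewrite -[RHS]A'1; apply: eq_bigr => j _.
transitivity (adjmx (A' j) *m (\sum_i adjmx (A i) *m A i) *m A' j).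
  rewrite mulmx_sumr mulmx_suml; apply: eq_bigr => i _.
  by rewrite adjmxM !mulmxA.
by rewrite A1 mulmx1.
Qed.

Lemma gauge_channel_pauli e (G : superop R (hdim K) (hdim K)) : gauge_channel G ->
  exists2 G', gauge_channel G' & G \o pauli_op e = pauli_op e \o G'.
Proof.
move=> [k [A [gA A1 ->]]].
exists (fun rho => \sum_j (pm e *m A j *m pm e) *m rho *m adjmx (pm e *m A j *m pm e)).
  apply: channel_with_fin => [j|]; first exact: gauge_alg_conj.
  transitivity (pm e *m (\sum_j adjmx (A j) *m A j) *m pm e).
    rewrite mulmx_sumr mulmx_suml; apply: eq_bigr => j _.
    by rewrite !adjmxM pauli_mx_adj -!mulmxA pauliK.
  by rewrite A1 mulmx1 pauli_mx_sq.
apply/funext => rho /=; rewrite /pauli_op mulmx_sumr mulmx_suml; apply: eq_bigr => j _.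
by rewrite !adjmxM pauli_mx_adj -!mulmxA pauliK pauli_mx_sq mulmx1.
Qed.

(** Monomials only, without sums and scalars: these are unitary on all of [H] and commute with every
    Pauli operator up to a sign. *)
Inductive gauge_word : H -> Prop :=
| gauge_word_gen j : gauge_word (pauli_mx (@gauge_op R K j))
| gauge_word1 : gauge_word 1%:M
| gauge_wordM A B : gauge_word A -> gauge_word B -> gauge_word (A *m B).

Lemma gauge_word_alg A : gauge_word A -> gauge_alg A.
Proof.
elim=> [j||B B' _ ? _ ?]; [exact: gauge_alg_gen|exact: gauge_alg1|exact: gauge_algM].
Qed.

Lemma gauge_word_unitary A : gauge_word A -> adjmx A *m A = 1%:M.
Proof.
elim=> [j||B B' _ IH _ IH']; first by rewrite pauli_mx_adj pauli_mx_sq.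
  by rewrite adjmx1 mulmx1.
by rewrite adjmxM mulmxA -[X in X *m _]mulmxA IH mulmx1.
Qed.

Lemma gauge_word_comm A e : gauge_word A ->
  exists b : bool, A *m pm e = (-1) ^+ b *: (pm e *m A).
Proof.
elim=> [j||B B' _ [b IH] _ [b' IH']].
- by exists (anticomm (@gauge_op R K j) e); rewrite pauli_mx_comm.
- by exists false; rewrite expr0 scale1r mul1mx mulmx1.
- exists (b (+) b'); rewrite -[LHS]mulmxA IH' -[LHS]scalemxAr.
  rewrite [X in _ *: X = _]mulmxA IH -scalemxAl scalerA.
  by rewrite signr_addb mulrC -mulmxA.
Qed.

(* Dual form of: the words span the gauge algebra. *)
Lemma gauge_word_span A : gauge_alg A -> forall Y : H,
  (forall B, gauge_word B -> \tr (Y *m B) = 0) -> \tr (Y *m A) = 0.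
Proof.
elim=> [j||B B' _ IH _ IH'|z B _ IH|B B' _ IH _ IH'] Y hY.
- exact/hY/gauge_word_gen.
- exact/hY/gauge_word1.
- by rewrite mulmxDr raddfD /= IH // IH' // addr0.
- by rewrite -scalemxAr mxtraceZ IH // mulr0.
(* Cyclicity of the trace lets [W] join [Y], so that both hypotheses apply and a single word
   [W' *m W] remains. *)
- rewrite mulmxA; apply: IH' => W wW; rewrite -mulmxA mxtrace_mulC -mulmxA mxtrace_mulC.
  apply: IH => W' wW'.
  rewrite -mulmxA mxtrace_mulC -mulmxA; apply: hY; exact: gauge_wordM.
Qed.

End GaugeAlgebra.

(** * Recovery on encoded states *)

Section Recovery.
Context {R : realType} {K : code_data R}.
Local Notation C := R[i].
Local Notation H := 'M[C]_(hdim K).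
Local Notation LG := 'M[C]_(ldim K * gdim K).
Local Notation pm e := (@pauli_mx R (qubit K) e : H).
Local Notation U := (emb K).
Implicit Types (s t : {set check K}) (e : pauli (qubit K)).
Context (K_code : is_code K).

Lemma gauge_alg_emb (A : H) : gauge_alg A -> exists a, A *m U = U *m (1%:M *t a).
Proof. by have [_ _ h _] := emb_decomposition K_code; exact: h. Qed.

Lemma gauge_alg_proj s (A : H) : is_syndrome s -> gauge_alg A ->
  A *m synd_proj s = synd_proj s *m A *m synd_proj s.
Proof.
move=> /(synd_decomposition K_code)[W [WW <- h _]] /h[a e].
rewrite -[RHS]mulmxA [A *m _]mulmxA e !mulmxA -[W *m adjmx W *m W]mulmxA WW.
by rewrite mulmx1.
Qed.

(** The Kraus operators act as [1 (x) a_j] on the code space, so only the gauge state changes. The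
    state that meets the decoder thus need not be [gstate K]. *)
Lemma gauge_channel_encode (G : superop R (hdim K) (hdim K)) (tau : 'M[C]_(gdim K)) :
  gauge_channel G -> is_state tau -> exists2 tau', is_state tau' &
    forall rho : 'M[C]_(ldim K),
      G (U *m (rho *t tau) *m adjmx U) = U *m (rho *t tau') *m adjmx U.
Proof.
move=> [k [A [gA A1 ->]]] [pt t1].
have [a ea] := choice (fun j => gauge_alg_emb (gA j)).
have a1 : \sum_j adjmx (a j) *m a j = 1%:M.
  apply: (tens1_inj (ldim_gt0 K_code)); rewrite tens11 -(emb_iso K_code).
  rewrite -[in RHS](mulmx1 (adjmx U)) -A1 mulmx_sumr mulmx_suml tens1_sum.
  apply: eq_bigr => j _; rewrite -tens1M -!mulmxA ea mulmxA -adjmxM ea.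
  by rewrite adjmxM adjmx_tens adjmx1 -mulmxA [adjmx U *m _]mulmxA emb_iso // mul1mx.
exists (\sum_j a j *m tau *m adjmx (a j)); first split.
- move=> v; rewrite mulmx_sumr mulmx_suml summxE; apply: sumr_ge0 => j _.
  have := pt (adjmx (a j) *m v); rewrite adjmxM adjmxK !mulmxA.
  by [].
- rewrite raddf_sum /= -t1 -[tau in RHS]mul1mx -a1 mulmx_suml raddf_sum.
  by apply: eq_bigr => j _; rewrite mxtrace_mulC mulmxA.
move=> rho; transitivity (U *m (\sum_j rho *t (a j *m tau *m adjmx (a j))) *m adjmx U).
  rewrite mulmx_sumr mulmx_suml; apply: eq_bigr => j _.
  transitivity ((A j *m U) *m (rho *t tau) *m adjmx (A j *m U)).
    by rewrite adjmxM !mulmxA.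
  rewrite ea adjmxM adjmx_tens adjmx1 -!mulmxA; congr (_ *m _).
  by rewrite !mulmxA !tensmx_mul mul1mx mulmx1.
congr (_ *m _ *m _); elim/big_rec2: _ => [|j y x _ ->]; first by rewrite tensmx0.
by apply/matrixP => i j'; rewrite !mxE mulrDr.
Qed.

Lemma proj_pauli_emb s e : synd_proj s *m (pm e *m U) =
  pm e *m (synd_proj (add2 s (psynd e)) *m U).
Proof.
by rewrite mulmxA -[s in LHS]add20 -(add2xx (psynd e)) add2A -pauli_proj mulmxA.
Qed.

Lemma synd_op_other s t (A : H) (Z : LG) : is_syndrome s -> is_syndrome t -> t <> s ->
  synd_proj s *m (A *m U) = A *m U ->
  synd_op t (A *m (U *m Z *m adjmx U) *m adjmx A) = 0.
Proof.
move=> ss st ts e; rewrite /synd_op.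
have -> : A *m (U *m Z *m adjmx U) *m adjmx A = (A *m U) *m Z *m adjmx (A *m U).
  by rewrite adjmxM !mulmxA.
by rewrite -e !mulmxA synd_proj_ortho // !mul0mx.
Qed.

Lemma synd_op_same s (A : H) (Z : LG) : is_syndrome s ->
  synd_proj s *m (A *m U) = A *m U ->
  synd_op s (A *m (U *m Z *m adjmx U) *m adjmx A) = A *m (U *m Z *m adjmx U) *m adjmx A.
Proof.
move=> ss e; rewrite /synd_op.
have -> : A *m (U *m Z *m adjmx U) *m adjmx A = (A *m U) *m Z *m adjmx (A *m U).
  by rewrite adjmxM !mulmxA.
rewrite -[in RHS]e [in RHS]adjmxM synd_proj_adj //.
by rewrite !mulmxA.
Qed.

(** After [e] an encoded state lies in the space of syndrome [psynd e], which gauge channels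
    preserve, so a single term of the recovery survives. Its gauge channel is then moved before
    [e]. *)
Lemma recov_encoded s e (F : superop R (hdim K) (hdim K)) : recov s F ->
  exists2 G, gauge_channel G & forall Z : LG,
    F (pauli_op e (U *m Z *m adjmx U)) =
    pauli_op (corr (add2 s (psynd e))) (pauli_op e (G (U *m Z *m adjmx U))).
Proof.
move=> [Gs gGs ->]; set t0 := psynd e.
have st0 : is_syndrome t0.
  by rewrite /t0 -[psynd e]add20 add2C; apply: is_syndrome_add => //; exact: is_syndrome0.
have h1 : synd_proj t0 *m (pm e *m U) = pm e *m U.
  by rewrite proj_pauli_emb /t0 add2xx proj_emb.
have [G gG eG] := gauge_channel_pauli e (gGs t0).
exists G => // Z.
have step t : is_syndrome t ->
    synd_op t (Gs t (pauli_op e (U *m Z *m adjmx U))) =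
    if t == t0 then Gs t0 (pauli_op e (U *m Z *m adjmx U)) else 0.
  move=> st; have [k [A [gA _ eA]]] := gGs t.
  have inv j : synd_proj t0 *m (A j *m pm e *m U) = A j *m pm e *m U.
    rewrite -[A j *m _ *m U]mulmxA -h1 [A j *m (synd_proj t0 *m _)]mulmxA.
    by rewrite gauge_alg_proj // !mulmxA synd_proj_sq.
  have lin : synd_op t (Gs t (pauli_op e (U *m Z *m adjmx U))) =
      \sum_j synd_op t ((A j *m pm e) *m (U *m Z *m adjmx U) *m adjmx (A j *m pm e)).
    rewrite eA /synd_op mulmx_sumr mulmx_suml; apply: eq_bigr => j _.
    by rewrite /pauli_op adjmxM !mulmxA.
  rewrite lin; have [tt|/eqP tt] := eqVneq t t0.
    rewrite -tt eA; apply: eq_bigr => j _.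
    by rewrite synd_op_same ?tt //  /pauli_op adjmxM !mulmxA.
  by rewrite big1 // => j _; apply: synd_op_other tt _.
rewrite (bigD1 t0) //= big1 ?addr0 => [|t /andP[st tt0]].
  by rewrite step // eqxx; congr pauli_op; exact: (congr1 (fun F => F _) eG).
by rewrite step // (negPf tt0) /pauli_op mulmx0 mul0mx.
Qed.

(** The state reaches the decoder with syndrome [add2 s (psynd e)], which selects one correction;
    [V] is the total operator read through [emb K]. *)
Lemma decode_encoded s e (Z : LG) : is_syndrome s ->
  Defs.decode (pauli_op (corr s) (pauli_op e (U *m Z *m adjmx U))) =
  let V := adjmx U *m (pm (corr (add2 s (psynd e))) *m pm (corr s) *m pm e *m U) in
  ptrace (V *m Z *m adjmx V).
Proof.
move=> ss; set t0 := add2 s (psynd e).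
have st0 : is_syndrome t0 by exact: is_syndrome_add.
have inv : synd_proj t0 *m (pm (corr s) *m pm e *m U) = pm (corr s) *m pm e *m U.
  rewrite -[pm (corr s) *m _ *m U]mulmxA.
  have h1 : synd_proj (psynd e) *m (pm e *m U) = pm e *m U.
    by rewrite proj_pauli_emb add2xx proj_emb.
  rewrite -h1 [pm (corr s) *m (synd_proj _ *m _)]mulmxA pauli_proj corr_psynd //.
  by rewrite [add2 (psynd e) s]add2C -/t0 !mulmxA synd_proj_sq.
have eX : pauli_op (corr s) (pauli_op e (U *m Z *m adjmx U)) =
    (pm (corr s) *m pm e) *m (U *m Z *m adjmx U) *m adjmx (pm (corr s) *m pm e).
  by rewrite /pauli_op adjmxM !mulmxA.
rewrite /Defs.decode (bigD1 t0) //= big1 ?addr0 => [|t /andP[st tt0]]; last first.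
  rewrite eX (synd_op_other _ _ _ _ inv) //; last exact/eqP.
  by rewrite /pauli_op mulmx0 mul0mx.
rewrite eX synd_op_same // /pauli_op !adjmxM adjmxK !pauli_mx_adj; congr ptrace.
by rewrite !mulmxA.
Qed.

Lemma mxtrace_tens1 (n : 'M[C]_(gdim K)) :
  \tr (1%:M *t n : LG) = (ldim K)%:R * \tr n.
Proof.
rewrite /mxtrace sum_tens_index.
under eq_bigr => a _ do under eq_bigr do rewrite tensmxE mxE eqxx mul1r.
by rewrite sumr_const card_ord mulr_natl.
Qed.

Lemma emb_tens_inj (a b : 'M[C]_(gdim K)) :
  U *m (1%:M *t a) = U *m (1%:M *t b) -> a = b.
Proof.
move=> /(congr1 (mulmx (adjmx U))); rewrite !mulmxA emb_iso // !mul1mx.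
exact: tens1_inj (ldim_gt0 K_code).
Qed.

(* On the code space [M] must be [1 (x) B]; some monomial [A] in the gauge
   operators then has nonzero overlap with [M], and as [M^* A] commutes up to sign
   with each gauge operator, nonzero trace forces all these signs to be [+], so
   that [M^* A] is a scalar on the code space. *)
Lemma logically_trivial_gauge (M : H) (tau : 'M[C]_(gdim K)) :
  adjmx M *m M = 1%:M ->
  M *m synd_proj finset.set0 = synd_proj finset.set0 *m M ->
  (forall A, gauge_alg A -> exists2 B, gauge_alg B & M *m A = B *m M) ->
  (forall e, exists b : bool, M *m pm e = (-1) ^+ b *: (pm e *m M)) ->
  is_state tau ->
  (forall rho : 'M[C]_(ldim K), let V := adjmx U *m (M *m U) in
     ptrace (V *m (rho *t tau) *m adjmx V) = rho) ->
  exists A z, [/\ gauge_word A, z * z^* = 1 & A *m U = z *: (M *m U)].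
Proof.
move=> M1 M0 Mg Ms [pt t1] idM.
have [V eV] : exists V, V = adjmx U *m (M *m U) by exists (adjmx U *m (M *m U)).
have idV (rho : 'M[C]_(ldim K)) : ptrace (V *m (rho *t tau) *m adjmx V) = rho.
  by rewrite eV; exact: idM.
have UU := emb_iso K_code.
have dg : (0 < ldim K * gdim K)%N by rewrite muln_gt0 (ldim_gt0 K_code) (gdim_gt0 K_code).
have MU : M *m U = U *m V.
  by rewrite eV mulmxA emb_proj // mulmxA -M0 -mulmxA proj_emb.
have V1 : adjmx V *m V = 1%:M.
  have : adjmx (U *m V) *m (U *m V) = 1%:M.
    by rewrite -MU adjmxM mulmxA -[_ *m adjmx M *m M]mulmxA M1 mulmx1.
  by rewrite adjmxM mulmxA -[_ *m adjmx U *m U]mulmxA UU mulmx1.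
have V2 : V *m adjmx V = 1%:M by exact: mulmx1C.
have t0 : tau != 0.
  by apply/eqP => t0; move: t1; rewrite t0 mxtrace0 => /esym/eqP; rewrite oner_eq0.
have [b0 Vt] := logical_identity (ldim_gt0 K_code) pt idV.
have nV a : exists a', V *m (1%:M *t a) = (1%:M *t a') *m V.
  have [_ _ _ /(_ a)[A gA eA]] := emb_decomposition K_code.
  have [B gB eB] := Mg _ gA; have [a' ea'] := gauge_alg_emb gB; exists a'.
  rewrite {1}eV -[_ *m (1%:M *t a)]mulmxA -[M *m U *m _]mulmxA -eA [M *m (A *m U)]mulmxA.
  rewrite eB -[B *m M *m U]mulmxA MU [B *m (U *m V)]mulmxA ea'.
  by rewrite -[U *m _ *m V]mulmxA [adjmx U *m _]mulmxA UU mul1mx.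
have [B VB] := normalizer_tens t0 Vt nV.
have [_ _ _ /(_ B)[A0 gA0 eA0]] := emb_decomposition K_code.
(* If every word had zero overlap with [M] on the code space, so would [A0], which agrees there with
   [M] and has overlap [ldim K * gdim K]. *)
have [A wA tA] : exists2 A, gauge_word A & \tr (U *m adjmx (M *m U) *m A) != 0.
  apply: contrapT => h; have : \tr (U *m adjmx (M *m U) *m A0) = 0.
    apply: gauge_word_span => // A wA; apply/eqP; apply: contra_notT h => h.
    by exists A.
  rewrite -mulmxA mxtrace_mulC -mulmxA eA0 -VB -MU.
  rewrite adjmxM -mulmxA [adjmx M *m _]mulmxA M1 mul1mx UU mxtrace1 => /eqP.
  by rewrite pnatr_eq0 -leqn0 leqNgt dg.
have [b eb] := gauge_alg_emb (gauge_word_alg wA).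
have [n en] : exists n, n = adjmx B *m b by exists (adjmx B *m b).
have Vn : adjmx V *m (1%:M *t b) = 1%:M *t n.
  by rewrite en {1}VB adjmx_tens adjmx1 tens1M.
have tn : \tr n != 0.
  apply: contra_neq tA => tn; rewrite -mulmxA mxtrace_mulC -mulmxA eb MU adjmxM.
  by rewrite -mulmxA [adjmx U *m _]mulmxA UU mul1mx Vn mxtrace_tens1 tn mulr0.
have M'U : adjmx M *m U = U *m adjmx V.
  rewrite -[adjmx M *m U]mulmx1 -V2 !mulmxA; congr (_ *m _).
  by rewrite -mulmxA -MU mulmxA M1 mul1mx.
have NU : adjmx M *m (A *m U) = U *m (1%:M *t n).
  by rewrite eb mulmxA M'U -mulmxA Vn.
have gen j : exists2 c, pm (@gauge_op R K j) *m U = U *m (1%:M *t c) &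
    n *m c = c *m n.
  pose x := pm (@gauge_op R K j); have [c ec] := gauge_alg_emb (@gauge_alg_gen R K j).
  have cc1 : c *m c = 1%:M.
    by apply: emb_tens_inj; rewrite tens11 -tens1M mulmxA -ec -mulmxA -ec pauliK mulmx1.
  have [b1 h1] := Ms (@gauge_op R K j).
  have [b2 h2] := gauge_word_comm (@gauge_op R K j) wA.
  exists c => //; rewrite -/x in ec h1 h2.
  have h1' : adjmx M *m x = (-1) ^+ b1 *: (x *m adjmx M).
    have := congr1 adjmx h1; rewrite adjmxZ !adjmxM pauli_mx_adj rmorphXn rmorphN1 => ->.
    by rewrite scalerA -expr2 sqrr_sign scale1r.
  have sgn : n *m c = (-1) ^+ (b1 (+) b2) *: (c *m n).
    apply: emb_tens_inj; rewrite tens1Z -!tens1M -scalemxAr !mulmxA -NU -ec.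
    rewrite -[_ *m U *m (1%:M *t n)]mulmxA -NU -mulmxA -[A *m U *m _]mulmxA -ec.
    rewrite [A *m (x *m U)]mulmxA h2 -scalemxAl -scalemxAr -[x *m A *m U]mulmxA.
    rewrite [adjmx M *m (x *m _)]mulmxA h1' -scalemxAl scalerA signr_addb mulrC.
    rewrite [x *m adjmx M *m _]mulmxA -[x *m adjmx M *m _ *m U]mulmxA.
    by rewrite -[x *m _ *m _]mulmxA.
  case: (b1 (+) b2) sgn => sgn; last by rewrite sgn scale1r.
  exfalso; move: tn; apply/negP; rewrite negbK.
  have : \tr n = - \tr n.
    rewrite -{1}[n]mulmx1 -cc1 mulmxA sgn expr1 scaleN1r mulNmx raddfN /=.
    by rewrite -mulmxA mxtrace_mulC -mulmxA cc1 mulmx1.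
  by move/eqP; rewrite -addr_eq0 -mulr2n mulrn_eq0.
(* Restricted to the code space, the generators generate all operators on the gauge factor, so [n]
   is central. *)
have cn (a : 'M[C]_(gdim K)) : n *m a = a *m n.
  have [_ _ _ /(_ a)[g gg eg]] := emb_decomposition K_code.
  suff [c ec cc] : exists2 c, g *m U = U *m (1%:M *t c) & n *m c = c *m n.
    by rewrite (emb_tens_inj (a := a) (b := c)) // -eg ec.
  elim: g / gg {eg} => [j||g h _ [c ec cc] _ [c' ec' cc']|x g _ [c ec cc]
                       |g h _ [c ec cc] _ [c' ec' cc']].
  - exact: gen.
  - by exists 1%:M; rewrite ?tens11 ?mulmx1 ?mul1mx.
  - exists (c + c'); first by rewrite mulmxDl ec ec' tens1D mulmxDr.
    by rewrite mulmxDl mulmxDr cc cc'.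
  - exists (x *: c); first by rewrite -scalemxAl ec tens1Z scalemxAr.
    by rewrite -scalemxAl -scalemxAr cc.
  - exists (c *m c'); first by rewrite -mulmxA ec' mulmxA ec -mulmxA tens1M.
    by rewrite mulmxA cc -!mulmxA cc'.
have [z nz] := central_mx_scalar cn.
have AU : A *m U = z *: (M *m U).
  rewrite eb MU scalemxAr; congr (_ *m _).
  rewrite -[1%:M *t b]mul1mx -V2 -mulmxA Vn nz.
  by rewrite -[z%:M]scalemx1 tens1Z tens11 -scalemxAr mulmx1.
exists A, z; split=> //.
(* [A *m U] and [M *m U] are both isometries, so [z] has modulus one. *)
have : adjmx (A *m U) *m (A *m U) = (z * z^* ) *: (adjmx (M *m U) *m (M *m U)).
  by rewrite AU adjmxZ -scalemxAl -scalemxAr scalerA mulrC.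
rewrite !adjmxM !mulmxA -[_ *m adjmx A *m A]mulmxA (gauge_word_unitary wA).
rewrite -[_ *m adjmx M *m M]mulmxA M1 !mulmx1 UU => /esym.
by move=> /matrixP/(_ (Ordinal dg) (Ordinal dg)); rewrite !mxE eqxx mulr1.
Qed.

Lemma recov_correctable s e (F B : superop R (hdim K) (hdim K)) : is_syndrome s ->
  recov s F -> up_to_gauge (pauli_op e) B ->
  Defs.decode (K := K) \o pauli_op (corr s) \o B \o @encode R K = id ->
  exists2 G, gauge_channel G &
    F \o B \o @encode R K = pauli_op (corr s) \o G \o @encode R K.
Proof.
move=> ss rF [G1 gG1 <-] idD.
(* Decoding succeeds by hypothesis for the gauge state [tau1], whereas the recovery round leaves
   [tau2]. What follows for [M] holds on the whole code space and so covers both. *)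
have [tau1 s1 e1] := gauge_channel_encode gG1 (gstate_state K_code).
have [G2 gG2 e2] := recov_encoded e rF.
have [tau2 s2 e3] := gauge_channel_encode gG2 s1.
set t0 := psynd e in e2; set w' := corr (add2 s t0).
pose M : H := pm w' *m pm (corr s) *m pm e.
have st : is_syndrome (add2 s t0) by exact: is_syndrome_add.
have M1 : adjmx M *m M = 1%:M.
  by rewrite /M !adjmxM !pauli_mx_adj -!mulmxA !pauliK pauli_mx_sq.
have M0 : M *m synd_proj finset.set0 = synd_proj finset.set0 *m M.
  rewrite /M -mulmxA pauli_proj mulmxA -[_ *m pm (corr s) *m _]mulmxA pauli_proj.
  rewrite mulmxA pauli_proj !corr_psynd // [add2 finset.set0 _]add2C add20.
  by rewrite -/t0 [add2 t0 s]add2C add2xx !mulmxA.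
have Mg A : gauge_alg A -> exists2 B', gauge_alg B' & M *m A = B' *m M.
  move=> gA; have [A1 gA1 eA1] := gauge_alg_pauli e gA.
  have [A2 gA2 eA2] := gauge_alg_pauli (corr s) gA1.
  have [A3 gA3 eA3] := gauge_alg_pauli w' gA2; exists A3 => //.
  by rewrite /M -mulmxA eA1 mulmxA -[_ *m _ *m A1]mulmxA eA2 mulmxA eA3 !mulmxA.
have Ms f : exists b : bool, M *m pm f = (-1) ^+ b *: (pm f *m M).
  exists (anticomm w' f (+) anticomm (corr s) f (+) anticomm e f).
  rewrite /M -!mulmxA [pm e *m pm f]pauli_mx_comm -!scalemxAr.
  rewrite [pm (corr s) *m (pm f *m _)]mulmxA [pm (corr s) *m pm f]pauli_mx_comm.
  rewrite -scalemxAl -scalemxAr -[pm f *m _ *m pm e]mulmxA.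
  rewrite [pm w' *m (pm f *m _)]mulmxA [pm w' *m pm f]pauli_mx_comm.
  rewrite -scalemxAl -[pm f *m pm w' *m _]mulmxA !scalerA !signr_addb.
  by congr (_ *: _); ring.
have idM (rho : 'M[C]_(ldim K)) : let V := adjmx U *m (M *m U) in
    ptrace (V *m (rho *t tau1) *m adjmx V) = rho.
  have /= := decode_encoded e (rho *t tau1) ss.
  rewrite -/t0 -/w' -/M => <-; rewrite -e1.
  exact: (congr1 (fun D => D rho) idD).
have [A [z [wA z1 AU]]] := logically_trivial_gauge M1 M0 Mg Ms s1 idM.
(* On the code space [A] is [M] up to a phase, and [corr s] times [M] is [w'] times [e] up to a
   sign, since [corr s] squares to 1. *)
exists ((fun rho => A *m rho *m adjmx A) \o G2 \o G1).
  do 2 apply: gauge_channel_comp => //.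
  exact: gauge_channel_unitary (gauge_word_alg wA) (gauge_word_unitary wA).
apply/funext => rho /=; rewrite /encode e1 e2 e3.
set Z := rho *t tau2.
have -> : pauli_op w' (pauli_op e (U *m Z *m adjmx U)) =
    (pm w' *m pm e *m U) *m Z *m adjmx (pm w' *m pm e *m U).
  by rewrite /pauli_op !adjmxM !mulmxA.
have -> : pauli_op (corr s) (A *m (U *m Z *m adjmx U) *m adjmx A) =
    (pm (corr s) *m (A *m U)) *m Z *m adjmx (pm (corr s) *m (A *m U)).
  by rewrite /pauli_op !adjmxM !mulmxA.
have -> : pm (corr s) *m (A *m U) =
    (z * (-1) ^+ anticomm (corr s) w') *: (pm w' *m pm e *m U).
  rewrite AU -scalemxAr -scalerA; congr (_ *: _).
  rewrite /M !mulmxA [pm (corr s) *m pm w']pauli_mx_comm -!scalemxAl.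
  by rewrite -!mulmxA pauliK.
rewrite conj_phase // rmorphM rmorphXn rmorphN1 mulrACA z1 mul1r -expr2 sqrr_sign.
by [].
Qed.

End Recovery.

(** * Classes of a code *)
Section CodeClasses.
Context {R : realType} {K : code_data R}.
Local Notation class := (set (formal_sum R (hdim K) (hdim K))).
Local Notation C := (@encode R K).

Lemma listed_gauge_form (I : finType) (p : I -> R)
    (X : I -> set (superop R (hdim K) (hdim K))) : listed (gauge_form p X).
Proof. by move=> A [J [l [q [F [qq _ _ ->]]]]]; exists J, q, F. Qed.

Lemma listed_sub m n (X Y : set (formal_sum R m n)) : X `<=` Y -> listed Y -> listed X.
Proof. by move=> XY lY A /XY; exact: lY. Qed.

Lemma listed_classP : listed (@classP R K).
Proof. by move=> A [I [p [e [_ /listed_gauge_form]]]]. Qed.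

Lemma listed_classL lambda : listed (@classL R K lambda).
Proof. by move=> A [I [p [e [_ /listed_gauge_form]]]]. Qed.

Lemma listed_classQ : listed (@classQ R K).
Proof. by move=> A [p [_ /listed_gauge_form]]. Qed.

Lemma classR_sub_classQ (V : recovery K) eta : classR V eta `<=` @classQ R K.
Proof. by move=> A []. Qed.

Lemma gauge_form_dirac (I : finType) (X : I -> set (superop R (hdim K) (hdim K))) i F :
  X i F -> gauge_form (fun j => (j == i)%:R) X (sone F).
Proof.
move=> XF; exists unit, (fun=> i), (fun=> 1), (fun=> F); split=> //.
- by split=> [_|]; rewrite ?ler01 // (big_pred1 tt) // => -[].
- move=> j; rewrite big_mkcond (big_pred1 tt) => [|[]] //.
  by rewrite eq_sym; case: eqP.
Qed.

Lemma prob_dirac (I : finType) (i : I) : prob (fun j => (j == i)%:R : R).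
Proof.
split=> [j|]; first by rewrite ler0n.
by rewrite (bigD1 i) //= eqxx big1 ?addr0 // => j /negPf ->.
Qed.

(** For the noiseless elements of [classL] and [classR]: their weight counts only against the empty
    set, where the bound is [x ^+ 0 = 1] even at [x = 0]. *)
Lemma expr_ge0_cases (x : R) (n : nat) : 0 <= x -> (n == 0%N)%:R <= x ^+ n.
Proof. by case: n => [|n] x0; rewrite ?expr0 // exprn_ge0. Qed.

Lemma pauli_op_PI : pauli_op (fun _ : qubit K => PI) = id :> superop R (hdim K) (hdim K).
Proof.
have e : pauli_mx (fun _ : qubit K => PI) = 1%:M :> 'M[R[i]]_(hdim K).
  by apply/matrixP => a b; rewrite !mxE /= prod_eq_enum_val.
by apply/funext => rho; rewrite /pauli_op e adjmx1 mulmx1 mul1mx.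
Qed.

Lemma up_to_gauge_self (E : superop R (hdim K) (hdim K)) : up_to_gauge E E.
Proof. by exists id => //; exact: gauge_channel_id. Qed.

Lemma classL_neq0 lambda : 0 <= lambda -> @classL R K lambda !=set0.
Proof.
move=> l0; exists (sone id), unit, (fun j => (j == tt)%:R), (fun _ _ => PI); split.
- exact: prob_dirac.
- by apply: gauge_form_dirac; rewrite pauli_op_PI; exact: up_to_gauge_self.
move=> S; rewrite (_ : supp _ = finset.set0); last by apply/setP => q; rewrite !inE.
rewrite finset.subset0 -cards_eq0; apply: le_trans (expr_ge0_cases _ l0).
rewrite big_mkcond (big_pred1 tt) => [|[]] //.
by case: eqP.
Qed.

Lemma recov_neq0 (s : {set check K}) : exists F, @recov R K s F.
Proof.
eexists; exists (fun=> id) => [t|]; [exact: gauge_channel_id | reflexivity].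
Qed.

Lemma classR_neq0 (V : recovery K) eta : 0 <= eta -> classR V eta !=set0.
Proof.
move=> e0; have [F rF] := recov_neq0 (proc finset.set0 (r := V)).
exists (sone F); split.
  pose s : syndrome K := exist _ (proc finset.set0) (proc_syndrome (r := V) finset.set0).
  exists (fun j => (j == s)%:R); split; first exact: prob_dirac.
  by apply: (@gauge_form_dirac _ (fun s : syndrome K => recov (val s))).
exists (fun j => (j == finset.set0)%:R); split; first exact: prob_dirac.
  by apply: (@gauge_form_dirac _ (fun y => recov (proc y))).
move=> x; apply: le_trans (expr_ge0_cases _ e0); rewrite cards_eq0 -finset.subset0.
rewrite big_mkcond (bigD1 finset.set0) //= eqxx big1 ?addr0; first by case: ifP.
by move=> y /negPf ->; rewrite if_same.
Qed.

Lemma gauge_id_mix (Om : finType) (mu : Om -> R) :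
  prob mu -> @gauge_id R K (mix mu (fun=> id)).
Proof.
move=> pm; exists Om, (fun=> tt), mu, (fun=> id); split=> //.
- by move=> []; rewrite -pm.2; apply: eq_bigl => w; rewrite eqxx.
- by move=> _; exact: up_to_gauge_self.
Qed.

(** The identity is a special case of earlier residual noise, which reduces the relation for [L]
    alone to the one for [L] after [N1]. *)
Lemma diamond_gauge_id (X Y : class) : listed X -> @gauge_id R K `<=` Y ->
  X `<=` diamond X Y.
Proof.
move=> lX gY A XA; have [I [p [E [pp eA]]]] := lX _ XA.
have := diamond_mix (A := E) (B := fun=> id) pp _ (gY _ (gauge_id_mix pp)).
by rewrite -eA; apply.
Qed.

Lemma approx_class_sub l m (X X' : set (formal_sum R l m)) d Y :
  X `<=` X' -> approx_class X' d Y -> approx_class X d Y.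
Proof. by move=> XX h A /XX; exact: h. Qed.

Lemma approx_noise l m n (D : superop R l m) (X N1 : set (formal_sum R m n))
    (N2 : set (formal_sum R m m)) N3 a b :
  approx_class X a N1 -> approx_class (diamond N1 N2) b N3 ->
  listed N1 -> listed N3 ->
  approx_class (class_comp (diamond X N2) D) (a + b) (class_comp N3 D).
Proof.
move=> XN NN l1 l3 _ [Z /diamondE[Om [mu [A [B [pm XA NB ->]]]]] <-].
have [W1 [m1 [f1 [A' [pm1 pf1 NA le1]]]]] := approx_couple_id XN l1 pm XA.
have NAB : diamond N1 N2 (mix m1 (fun w => A' w \o B (f1 w))).
  by apply: (diamond_mix (B := B \o f1)) => //; rewrite (mix_push _ pf1).
have [W2 [m2 [f2 [M [pm2 pf2 NM le2]]]]] := approx_couple_id NN l3 pm1 NAB.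
exists (termwise (fun E => E \o D) (mix m2 M)); first by exists (mix m2 M).
rewrite -(mix_push _ (pushes_comp pf2 pf1)) !termwise_mix.
apply: le_trans (sdist_mix_le _ _ pm2) _.
rewrite -(Pr_push _ pf2) in le1.
apply: (Pr_union_le pm2 le1 le2) => w.
apply: contra_notP => /not_orP[/contrapT h1 /contrapT h2].
by rewrite /= -h2 h1.
Qed.

(* The gauge channels of an element of [eff Rc] are free, so the comparison is made
   twice: with trivial ones, to bound the probability of a failed decoding, and with
   those that match [Rc] on the code space. *)
Lemma approx_recovery (Rc N1 N2 N3 : class) a b c : is_code K ->
  Rc `<=` @classQ R K -> N2 `<=` @classP R K -> listed N1 -> listed N3 ->
  approx_class (eff Rc) a N1 -> approx_class (diamond N1 N2) b N3 -> fail N3 <= c ->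
  approx_class (class_comp (diamond Rc N2) C) (2 * a + b + c) (class_comp N1 C).
Proof.
move=> K_code RQ NP l1 l3 RN NN N3c _ [Z /diamondE[Om [mu [F [B [pm RF NB ->]]]]] <-].
have [q [qq gF]] := RQ _ RF.
have [W1 [m1 [f1 [s [F' [pm1 pf1 qs rF' le1]]]]]] := gauge_couple pm gF.
rewrite -(mix_push B pf1) in NB.
have [I [p [e [_ gB]]]] := NP _ NB.
have [W2 [m2 [f2 [u [B' [pm2 pf2 _ uB' le2]]]]]] := gauge_couple pm1 gB.
pose w_ w : superop R (hdim K) (hdim K) := pauli_op (corr (val (s (f2 w)))).
pose good w := Defs.decode (K := K) \o w_ w \o B' w \o C = id.
(* Where decoding fails the identity is a placeholder; such outcomes are charged to [bad]. *)
have exG w : exists G : superop R (hdim K) (hdim K),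
    gauge_channel G /\ (good w -> F' (f2 w) \o B' w \o C = w_ w \o G \o C).
  have [gw|ngw] := pselect (good w); last by exists id; split; [exact: gauge_channel_id|].
  have [G gG eG] := recov_correctable K_code (valP (s (f2 w))) (rF' (f2 w)) (uB' w) gw.
  by exists G.
have [G /all_and2[gG eG]] := choice exG.
(* Membership in [eff Rc] constrains only the law of the syndrome label, so every choice of gauge
   channels stays inside. *)
have inE (G' : W2 -> superop R (hdim K) (hdim K)) : (forall w, gauge_channel (G' w)) ->
    eff Rc (mix m2 (fun w => w_ w \o G' w)).
  move=> gG'; exists q; split=> //; first by exists (mix mu F).
  exists W2, (s \o f2), m2, (fun w => w_ w \o G' w); split=> //.
    move=> i; rewrite qs (partition_big f2 (fun w => s w == i)) //=.
    apply: eq_bigr => w /eqP sw; rewrite -pf2; apply: eq_bigl => w'.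
    by case: (f2 w' =P w) => [->|]; rewrite ?andbF // sw eqxx.
  by move=> w; exists (G' w).
(* The spaces [W3] and [W4] serve only this bound; the second coupling starts again from [W2]. *)
have bad : Pr m2 (fun w => ~ good w) <= a + (b + c).
  have [W3 [m3 [f3 [M [pm3 pf3 NM le3]]]]] :=
    approx_couple_id RN l1 pm2 (inE (fun=> id) (fun=> gauge_channel_id)).
  have NB' : N2 (mix m2 B').
    by rewrite -(mix_ae pm2 le2) -/(comp _ f2) (mix_push _ pf2).
  have MB : diamond N1 N2 (mix m3 (fun w => M w \o B' (f3 w))).
    by apply: (diamond_mix (B := B' \o f3)) => //; rewrite (mix_push _ pf3).
  have [W4 [m4 [f4 [M' [pm4 pf4 NM' le4]]]]] := approx_couple_id NN l3 pm3 MB.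
  rewrite -(Pr_push _ pf4) in le3.
  rewrite -(Pr_push _ (pushes_comp pf4 pf3)).
  have le5 := le_trans (Pr_le_fail l3 pm4 NM') N3c.
  apply: (Pr_union_le pm4 le3 (Pr_union_le pm4 le4 le5 (fun _ => id))) => w.
  apply: contra_notP => /not_orP[/contrapT h1 /not_orP[/contrapT h2 /contrapT h3]].
  by rewrite /good -[RHS]h3 -h2 -h1.
have [W5 [m5 [f5 [M [pm5 pf5 NM le5]]]]] := approx_couple_id RN l1 pm2 (inE G gG).
exists (termwise (fun E => E \o C) (mix m5 M)); first by exists (mix m5 M).
rewrite -(mix_push _ (pushes_comp pf5 (pushes_comp pf2 pf1))) !termwise_mix.
apply: le_trans (sdist_mix_le _ _ pm5) _.
rewrite -(Pr_push _ (pushes_comp pf5 pf2)) in le1.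
rewrite -(Pr_push _ pf5) in le2; rewrite -(Pr_push _ pf5) in bad.
(* In order: relisting [F], relisting [B], failed decodings, and replacement of the adapted element
   of [eff Rc] by [N1]. *)
have -> : 2 * a + b + c = 0 + (0 + (a + (b + c) + a)) by ring.
apply: (Pr_union_le pm5 le1 (Pr_union_le pm5 le2
  (Pr_union_le pm5 bad le5 (fun _ => id)) (fun _ => id))) => w.
apply: contra_notP => /not_orP[/contrapT h1 /not_orP[/contrapT h2
  /not_orP[/contrapT h3 /contrapT h4]]].
have {}h1 : F (f1 (f2 (f5 w))) = F' (f2 (f5 w)) := h1.
have {}h2 : B (f1 (f2 (f5 w))) = B' (f5 w) := h2.
by rewrite /= -h4 -(eG _ h3) -h1 -h2.
Qed.

End CodeClasses.

(** * Thresholds from limits at the origin *)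

Section Thresholds.
Context {R : realType}.

Lemma near0_lt (P : R -> Prop) : (\forall x \near nbhs (0 : R), P x) ->
  exists2 r, 0 < r & forall x, 0 <= x -> x < r -> P x.
Proof.
move=> /nbhs_ballP[r /= r0 rP]; exists r => // x x0 xr; apply: rP.
by rewrite /ball /= sub0r normrN ger0_norm.
Qed.

Lemma near00_lt (P : R * R -> Prop) : (\forall z \near nbhs ((0, 0) : R * R), P z) ->
  exists2 r, 0 < r & forall x y, 0 <= x -> 0 <= y -> x < r -> y < r -> P (x, y).
Proof.
move=> /nbhs_ballP[r /= r0 rP]; exists r => // x y x0 y0 xr yr; apply: rP.
by split; rewrite /ball /= sub0r normrN ger0_norm.
Qed.

(** The limit is punctured and says nothing at [x = 0]; by monotonicity the value at the midpoint
    [(x + r) / 2], positive and below [r], bounds [g x]. *)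
Lemma incr_lim0_lt (g : R -> R) : (forall x x', 0 <= x -> x <= x' -> g x <= g x') ->
  g x @[x --> 0^'+] --> (0 : R) -> forall e, 0 < e ->
  exists2 r, 0 < r & forall x, 0 <= x -> x < r -> g x < e.
Proof.
move=> g_incr /cvgrPdist_lt lim e /lim {}lim.
have [r r0 rP] := near0_lt lim; exists r => // x x0 xr.
have xy : x <= (x + r) / 2 by lra.
apply: le_lt_trans (g_incr _ _ x0 xy) _.
have := rP ((x + r) / 2); rewrite sub0r normrN => /(_ _ _ _)/ltr_normlW; apply; lra.
Qed.

Lemma incr2_lim0_lt (g : R -> R -> R) :
  (forall x x' y, 0 <= y -> 0 <= x -> x <= x' -> g x y <= g x' y) ->
  (forall x y y', 0 <= x -> 0 <= y -> y <= y' -> g x y <= g x y') ->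
  (fun z : R * R => g z.1 z.2) @
    within [set z : R * R | 0 <= z.1 /\ 0 <= z.2] (dnbhs ((0, 0) : R * R))
    --> (0 : R) -> forall e, 0 < e ->
  exists2 r, 0 < r & forall x y, 0 <= x -> 0 <= y -> x < r -> y < r -> g x y < e.
Proof.
move=> gl gr /cvgrPdist_lt lim e /lim {}lim.
have [r r0 rP] := near00_lt lim; exists r => // x y x0 y0 xr yr.
pose x' := (x + r) / 2; pose y' := (y + r) / 2.
have xx : x <= x' by rewrite /x'; lra.
have yy : y <= y' by rewrite /y'; lra.
have x'0 : 0 < x' by rewrite /x'; lra.
have x'r : x' < r by rewrite /x'; lra.
have y'r : y' < r by rewrite /y'; lra.
have y'0 : 0 <= y' by rewrite /y'; lra.
apply: le_lt_trans (gl _ _ _ y0 x0 xx) (le_lt_trans (gr _ _ _ (ltW x'0) y0 yy) _).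
have := rP _ _ (ltW x'0) y'0 x'r y'r; rewrite /= sub0r normrN => h.
apply: ltr_normlW; apply: h; last by split=> //; exact: ltW.
by apply/eqP => -[x'z _]; rewrite x'z ltxx in x'0.
Qed.

End Thresholds.

Theorem mainTheorem1 (R : realType)
    (K : nat -> code_data R) (K_code : forall k, is_code (K k))
    (K_size : forall k, (#|qubit (K k)| < #|qubit (K k.+1)|)%N)
    (V : forall k, recovery (K k))
    (N : forall k, R -> set (formal_sum R (hdim (K k)) (hdim (K k))))
    (N_P : forall k tau, 0 <= tau -> N k tau `<=` @classP R (K k))
    (g1 : R -> R) (g2 : R -> R -> R) (g4 : R -> R)
    (f1 : nat -> R -> R) (f2 : nat -> R -> R -> R) (f3 f4 : nat -> R -> R)
    (* (i) *)
    (g1_ge0 : forall x, 0 <= x -> 0 <= g1 x)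
    (g2_ge0 : forall x y, 0 <= x -> 0 <= y -> 0 <= g2 x y)
    (g4_ge0 : forall x, 0 <= x -> 0 <= g4 x)
    (g1_lim : g1 x @[x --> 0^'+] --> (0 : R))
    (g2_lim : (fun z : R * R => g2 z.1 z.2) @
       within [set z : R * R | 0 <= z.1 /\ 0 <= z.2] (dnbhs ((0, 0) : R * R))
       --> (0 : R))
    (g4_lim : g4 x @[x --> 0^'+] --> (0 : R))
    (g1_incr : forall x x', 0 <= x -> x <= x' -> g1 x <= g1 x')
    (g2_incrl : forall x x' y, 0 <= y -> 0 <= x -> x <= x' -> g2 x y <= g2 x' y)
    (g2_incrr : forall x y y', 0 <= x -> 0 <= y -> y <= y' -> g2 x y <= g2 x y')
    (g4_incr : forall x x', 0 <= x -> x <= x' -> g4 x <= g4 x')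
    (* (ii) *)
    (f1_lim : \forall x \near nbhs (0 : R), 0 <= x ->
       f1 k x @[k --> \oo] --> (0 : R))
    (f2_lim : \forall z \near nbhs ((0, 0) : R * R), 0 <= z.1 -> 0 <= z.2 ->
       f2 k z.1 z.2 @[k --> \oo] --> (0 : R))
    (f3_lim : \forall x \near nbhs (0 : R), 0 <= x ->
       f3 k x @[k --> \oo] --> (0 : R))
    (f4_lim : \forall x \near nbhs (0 : R), 0 <= x ->
       f4 k x @[k --> \oo] --> (0 : R))
    (* (iii) *)
    (L_N : forall k lambda, 0 <= lambda ->
       approx_class (@classL R (K k) lambda) (f1 k lambda) (N k (g1 lambda)))
    (N_N : forall k t1 t2, 0 <= t1 -> 0 <= t2 ->
       approx_class (diamond (N k t1) (N k t2)) (f2 k t1 t2) (N k (g2 t1 t2)))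
    (N_fail : forall k tau, 0 <= tau -> fail (N k tau) <= f3 k tau)
    (R_N : forall k eta, 0 <= eta ->
       approx_class (eff (classR (V k) eta)) (f4 k eta) (N k (g4 eta)))
    (* (iv) *)
    (N_incr : forall k tau tau', 0 <= tau -> tau <= tau' ->
       N k tau `<=` N k tau')
    (N_0 : forall k, N k 0 = @gauge_id R (K k)) :
  let t1 := tau1 g4 in
  let t2 := tau2 g1 g2 g4 in
  let d1 k := delta1 g1 g2 g4 (f2 k) (f3 k) (f4 k) in
  let d2 k := delta2 g1 g4 (f1 k) (f2 k) in
  let d3 k := delta3 g4 (f3 k) in
  let L k := @classL R (K k) in
  let Rec k := classR (V k) in
  let C k := @encode R (K k) in
  (forall lambda eta, 0 <= lambda -> 0 <= eta -> forall k,
     [/\ approx_class (class_comp (diamond (Rec k eta) (N k (t2 lambda eta))) (C k))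
           (d1 k lambda eta) (class_comp (N k (t1 eta)) (C k)),
         approx_class (class_comp (diamond (L k lambda) (N k (t1 eta))) (C k))
           (d2 k lambda eta) (class_comp (N k (t2 lambda eta)) (C k)),
         approx_class (class_comp (L k lambda) (C k))
           (d2 k lambda eta) (class_comp (N k (t2 lambda eta)) (C k)),
         fail (N k (t1 eta)) <= d3 k eta &
         forall n, (1 <= n)%N ->
           fail (diamond_pow (diamond (Rec k eta) (L k lambda)) n)
             <= n%:R * (d1 k lambda eta + d2 k lambda eta) + d3 k eta])
  /\
  (exists lambda0 eta0 : R, [/\ 0 < lambda0, 0 < eta0 &
     forall lambda eta, 0 <= lambda -> lambda < lambda0 ->
       0 <= eta -> eta < eta0 ->
       [/\ d1 k lambda eta @[k --> \oo] --> (0 : R),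
           d2 k lambda eta @[k --> \oo] --> (0 : R),
           d3 k eta @[k --> \oo] --> (0 : R) &
           forall n, (1 <= n)%N -> forall eps : R, 0 < eps ->
             \forall k \near \oo,
               fail (diamond_pow (diamond (Rec k eta) (L k lambda)) n) < eps]]).
Proof.
move=> t1 t2 d1 d2 d3 L Rec C.
have lN k tau : 0 <= tau -> listed (N k tau).
  by move=> t0; apply: listed_sub (N_P k tau t0) _; exact: listed_classP.
have main lambda eta : 0 <= lambda -> 0 <= eta -> forall k,
     [/\ approx_class (class_comp (diamond (Rec k eta) (N k (t2 lambda eta))) (C k))
           (d1 k lambda eta) (class_comp (N k (t1 eta)) (C k)),
         approx_class (class_comp (diamond (L k lambda) (N k (t1 eta))) (C k))
           (d2 k lambda eta) (class_comp (N k (t2 lambda eta)) (C k)),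
         approx_class (class_comp (L k lambda) (C k))
           (d2 k lambda eta) (class_comp (N k (t2 lambda eta)) (C k)),
         fail (N k (t1 eta)) <= d3 k eta &
         forall n, (1 <= n)%N ->
           fail (diamond_pow (diamond (Rec k eta) (L k lambda)) n)
             <= n%:R * (d1 k lambda eta + d2 k lambda eta) + d3 k eta].
  move=> l0 e0 k.
  have t10 : 0 <= t1 eta by exact: g4_ge0.
  have t20 : 0 <= t2 lambda eta by apply: g2_ge0 => //; exact: g1_ge0.
  have t30 : 0 <= g2 (t1 eta) (t2 lambda eta) by exact: g2_ge0.
  have RN : approx_class (class_comp (diamond (Rec k eta) (N k (t2 lambda eta))) (C k))
      (d1 k lambda eta) (class_comp (N k (t1 eta)) (C k)).
    apply: (approx_recovery (N3 := N k (g2 (t1 eta) (t2 lambda eta)))) => //.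
    - exact: classR_sub_classQ.
    - exact: N_P.
    - exact: lN.
    - exact: lN.
    - exact: R_N.
    - exact: N_N.
    - exact: N_fail.
  have LN : approx_class (class_comp (diamond (L k lambda) (N k (t1 eta))) (C k))
      (d2 k lambda eta) (class_comp (N k (t2 lambda eta)) (C k)).
    apply: (approx_noise (N1 := N k (g1 lambda))).
    - exact: L_N.
    - by apply: N_N => //; exact: g1_ge0.
    - by apply: lN; exact: g1_ge0.
    - exact: lN.
  have LN0 : approx_class (class_comp (L k lambda) (C k))
      (d2 k lambda eta) (class_comp (N k (t2 lambda eta)) (C k)).
    apply: approx_class_sub LN; apply: image_subset; apply: diamond_gauge_id.
      exact: listed_classL.
    by rewrite -N_0; exact: N_incr.
  have NF : fail (N k (t1 eta)) <= d3 k eta by exact: N_fail.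
  split=> // n n1; apply: memory_fail LN0 LN RN NF _ _ _ _ _ _ n1.
  - exact: lN.
  - exact: lN.
  - by apply: listed_sub (@classR_sub_classQ _ _ _ _) _; exact: listed_classQ.
  - exact: listed_classL.
  - exact: classR_neq0.
  - exact: classL_neq0.
split=> //.
have [a1 a10 f1P] := near0_lt f1_lim; have [a2 a20 f2P] := near00_lt f2_lim.
have [a3 a30 f3P] := near0_lt f3_lim; have [a4 a40 f4P] := near0_lt f4_lim.
(* Radii are chosen backwards: [b2] controls [g2 t1 t2] as an argument of [f3], [c2] controls [t2],
   and [e] controls [g1 lambda] and [t1], the latter also as an argument of [f3] in [d3]. *)
have [b2 b20 b2P] := incr2_lim0_lt g2_incrl g2_incrr g2_lim a30.
pose m := Num.min a2 b2.
have m0 : 0 < m by rewrite lt_min a20 b20.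
have [c2 c20 c2P] := incr2_lim0_lt g2_incrl g2_incrr g2_lim m0.
pose e := Num.min (Num.min m c2) a3.
have e0 : 0 < e by rewrite lt_min a30 andbT lt_min m0 c20.
have [r1 r10 r1P] := incr_lim0_lt g1_incr g1_lim e0.
have [r4 r40 r4P] := incr_lim0_lt g4_incr g4_lim e0.
exists (Num.min r1 a1), (Num.min r4 a4); rewrite !lt_min r10 a10 r40 a40; split=> //.
move=> lambda eta l0; rewrite lt_min => /andP[lr1 la1] h0; rewrite lt_min => /andP[hr4 ha4].
have g10 := g1_ge0 _ l0; have t10 : 0 <= t1 eta by exact: g4_ge0.
have := r1P _ l0 lr1; rewrite !lt_min => /andP[/andP[/andP[g1a2 g1b2] g1c2] g1a3].
have := r4P _ h0 hr4; rewrite !lt_min => /andP[/andP[/andP[t1a2 t1b2] t1c2] t1a3].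
have t20 : 0 <= t2 lambda eta by exact: g2_ge0.
have := c2P _ _ g10 t10 g1c2 t1c2; rewrite lt_min => /andP[t2a2 t2b2].
have t30 : 0 <= g2 (t1 eta) (t2 lambda eta) by exact: g2_ge0.
have t3a3 := b2P _ _ t10 t20 t1b2 t2b2.
have d10 : d1 k lambda eta @[k --> \oo] --> (0 : R).
  have -> : (0 : R) = 2 * 0 + 0 + 0 by rewrite mulr0 !addr0.
  apply: cvgD; last exact: f3P.
  apply: cvgD; last exact: (f2P _ _ t10 t20 t1a2 t2a2 t10 t20).
  by apply: cvgMr; exact: f4P.
have d20 : d2 k lambda eta @[k --> \oo] --> (0 : R).
  have -> : (0 : R) = 0 + 0 by rewrite addr0.
  apply: cvgD; first exact: f1P.
  exact: (f2P _ _ g10 t10 g1a2 t1a2 g10 t10).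
have d30 : d3 k eta @[k --> \oo] --> (0 : R) by exact: f3P.
split=> // n n1 eps eps0.
have : n%:R * (d1 k lambda eta + d2 k lambda eta) + d3 k eta @[k --> \oo] --> (0 : R).
  have -> : (0 : R) = n%:R * (0 + 0) + 0 by rewrite !addr0 mulr0.
  by apply: cvgD => //; apply: cvgMr; exact: cvgD.
move=> /cvgrPdist_lt/(_ _ eps0); apply: filterS => k; rewrite sub0r normrN => lt.
have [_ _ _ _ /(_ n n1) le] := main lambda eta l0 h0 k.
exact: le_lt_trans le (le_lt_trans (ler_norm _) lt).
Qed.
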